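(* Suppose that Assumptions 1, 2 and 3 (stated in the context) hold, and let $\{x_k\}$ be the sequence generated by the Anderson(1)-SEG algorithm (described in the context). Then, almost surely, the sequence $\{x_k\}$ converges to a solution of ${\rm SVI}(X,H)$ and $r_\gamma(x_k)$ converges to $0$.
   Context: Setting. $X\subseteq\mathbb{R}^n$ is a closed convex set, $(\Xi,\mathcal{G})$ is a measurable space, $T:\Xi\times\mathbb{R}^n\to\mathbb{R}^n$ is measurable, and $\xi:\Omega\to\Xi$ is a random variable on a probability space $(\Omega,\mathcal{F},\mathbb{P})$. Put $H(x):=\mathbb{E}[T(\xi,x)]$. ${\rm SVI}(X,H)$ is the problem of finding $x^*\in X$ with $\langle H(x^* ),x-x^*\rangle\ge 0$ for all $x\in X$; its solution set is ${\rm SOL}(X,H)$, assumed nonempty. $P_X$ is the Euclidean projection onto $X$, $\|\cdot\|$ is the Euclidean norm, and $r_t(x):=\|P_X(x-tH(x))-x\|$ for $t>0$. Assumption 1. $H$ is pseudomonotone on $X$: for all $x,y\in X$, $\langle H(x),y-x\rangle\ge 0$ implies $\langle H(y),y-x\rangle\ge 0$. Assumption 2. (i) There is a measurable $L:\Xi\to\mathbb{R}$ with $L(\xi)\ge 1$ with probability $1$, with $\|T(\xi,x)-T(\xi,y)\|\le L(\xi)\|x-y\|$ for any $x,y\in\mathbb{R}^n$, and with $\mathbb{E}[L(\xi)^{2p}]<\infty$ for $p\ge 2$ (every $p\ge2$). (ii) There exist $\check{x}\in\mathbb{R}^n$ and a number $\bar q\ge 2$ such that $\mathbb{E}[\|T(\xi,\check{x})\|^{2\bar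 q}]<\infty$. Assumption 3. In the algorithm below, $\{\xi^k_j\}_{j=1}^{S_k}$ and $\{\eta^k_j\}_{j=1}^{S_k}$ are two mutually independent sets of i.i.d. samples drawn from $\xi$, and $\sum_{k=0}^\infty \frac{1}{\sqrt{S_k}}<\infty$. Samples of iteration $k$ are also independent of those of earlier iterations: writing $\xi^k=\{\xi^k_j\}_{j=1}^{S_k}$, $\eta^k=\{\eta^k_j\}_{j=1}^{S_k}$, $\mathcal{F}_k=\sigma(x_0,\xi^0,\dots,\xi^{k-1},\eta^0,\dots,\eta^{k-1})$ and $\hat{\mathcal{F}}_k=\sigma(x_0,\xi^0,\dots,\xi^{k},\eta^0,\dots,\eta^{k-1})$, $\xi^k$ is independent of $\mathcal{F}_k$ and $\eta^k$ is independent of $\hat{\mathcal{F}}_k$. Anderson(1)-SEG algorithm. Initialization: choose $x_0\in X$, $\nu\ge 0$, $\gamma\in(0,1]$, $\rho\in(0,1)$, $\mu\in(0,\frac{\sqrt3}{3})$, $\tau>\frac12$, $\theta_0=1$, a sequence of positive integers $\{S_k\}$ (sample rate), and a (sufficiently large) $M>0$. Write $H_{\xi^k}(x)=\frac1{S_k}\sum_{j=1}^{S_k}T(\xi^k_j,x)$ and $H_{\eta^k}(x)=\frac1{S_k}\sum_{j=1}^{S_k}T(\eta^k_j,x)$. For $k=0,1,2,\dots$: Step 1: generate samples $\{\xi^k_j\}_{j=1}^{S_k}$, $\{\eta^k_j\}_{j=1}^{S_k}$ of $\xi$. Let $t_k=\gamma$ and compute $F_{\gamma,\xi^k}=P_X(x_k-\gamma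 H_{\xi^k}(x_k))-x_k$. If $F_{\gamma,\xi^k}=\mathbf 0$, set $x_{k+1}=x_k$, $\theta_{k+1}=\theta_k$ (and pass to the next $k$). Otherwise go to Step 2. Step 2 (line search): compute $y_{k+0.5}=P_X(x_k-t_kH_{\xi^k}(x_k))$. If $t_k\|H_{\xi^k}(x_k)-H_{\xi^k}(y_{k+0.5})\|\le\mu\|x_k-y_{k+0.5}\|$, go to Step 3. Otherwise set $t_k=\rho t_k$ and repeat Step 2. Step 3: compute $F_{t_k,\xi^k}=y_{k+0.5}-x_k$, $y_{k+1}=P_X(x_k-t_kH_{\eta^k}(y_{k+0.5}))$ and $\tilde F_{t_k,\eta^k}=y_{k+1}-x_k$. If $\|\tilde F_{t_k,\eta^k}\|<\min\{\|F_{t_k,\xi^k}\|,\nu\theta_k^{-\tau}\}$, set $\alpha_k=\frac{\langle\tilde F_{t_k,\eta^k},\tilde F_{t_k,\eta^k}-F_{t_k,\xi^k}\rangle}{\|\tilde F_{t_k,\eta^k}-F_{t_k,\xi^k}\|^2}$. Otherwise set $\alpha_k=M+1$. Step 4: if $|\alpha_k|\le M$, set $x_{k+1}=\alpha_kx_k+(1-\alpha_k)y_{k+1}$ and $\theta_{k+1}=\theta_k+1$. Otherwise set $x_{k+1}=y_{k+1}$ and $\theta_{k+1}=\theta_k$. *)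

(* Defs.v *)
From HB Require Import structures.
From mathcomp Require Import all_boot all_order all_algebra.
From mathcomp Require Import all_classical all_reals all_analysis.

Set Implicit Arguments.
Unset Strict Implicit.
Unset Printing Implicit Defensive.

Import Order.TTheory GRing.Theory Num.Theory.
Import numFieldNormedType.Exports.

Local Open Scope classical_set_scope.
Local Open Scope ring_scope.

Section euclidean.
Context {R : realType} {n : nat}.
Implicit Types (u v x p : 'rV[R]_n) (X : set 'rV[R]_n).

Definition dotv u v : R := \sum_(i < n) u 0 i * v 0 i.

(* The library norm on 'rV[R]_n is the sup norm, hence a separate constant;
   the two norms induce the same topology. *)
Definition enorm u : R := Num.sqrt (dotv u u).

Definition is_proj X x p := X p /\ forall q, X q -> enorm (x - p) <= enorm (x - q).

(* For X nonempty, closed and convex there is exactly one such point. *)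
Definition proj X x : 'rV[R]_n := xget 0 [set p | is_proj X x p].

End euclidean.

(* R^n with its Borel sigma-algebra. *)
Definition borelRn (R : realType) (n : nat) := g_sigma_algebraType (@open 'rV[R]_n).

Section variational_inequality.
Context {R : realType} {n : nat}.
Variables (X : set 'rV[R]_n) (H : 'rV[R]_n -> 'rV[R]_n).

Definition SOL : set 'rV[R]_n :=
  [set xs | X xs /\ forall x, X x -> 0 <= dotv (H xs) (x - xs)].

Definition pseudomonotone := forall x y, X x -> X y ->
  0 <= dotv (H x) (y - x) -> 0 <= dotv (H y) (y - x).

Definition residual (t : R) (x : 'rV[R]_n) : R := enorm (proj X (x - t *: H x) - x).

End variational_inequality.

Section averages.
Context {R : realType} {n : nat}.

Definition mean_map d (Omega : measurableType d) (P : probability Omega R)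
    (Xi : Type) (T : Xi -> 'rV[R]_n -> 'rV[R]_n) (xi : Omega -> Xi)
    (x : 'rV[R]_n) : 'rV[R]_n :=
  \row_i fine 'E_P[fun w => T (xi w) x 0 i].

Definition sample_mean (Xi : Type) (T : Xi -> 'rV[R]_n -> 'rV[R]_n)
    (N : nat) (z : 'I_N -> Xi) (x : 'rV[R]_n) : 'rV[R]_n :=
  N%:R^-1 *: \sum_(j < N) T (z j) x.

End averages.

Section independence.
Context d {Omega : measurableType d} {R : realType} (P : probability Omega R).

Definition indep_systems (F G : set_system Omega) :=
  forall A B, F A -> G B -> P (A `&` B) = (P A * P B)%E.

Definition mutually_indep d' (E : measurableType d') (I : finType)
    (f : I -> Omega -> E) :=
  forall (J : {set I}) (B : I -> set E), (forall i, measurable (B i)) ->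
    P (\big[setI/setT]_(i in J) (f i @^-1` B i)) =
    (\prod_(i in J) P (f i @^-1` B i))%E.

Definition same_law d' (E : measurableType d') (f g : Omega -> E) :=
  forall B, measurable B -> P (f @^-1` B) = P (g @^-1` B).

End independence.

Section filtrations.
Context {R : realType} {n : nat} d (Omega : measurableType d)
  d' (Xi : measurableType d') (S : nat -> nat).
Implicit Types xis etas s : forall k, 'I_(S k) -> Omega -> Xi.

Definition batch_events s (k : nat) : set_system Omega :=
  \bigcup_(j : 'I_(S k)) preimage_set_system setT (s k j) measurable.

Definition init_events (x0 : Omega -> 'rV[R]_n) : set_system Omega :=
  preimage_set_system setT (x0 : Omega -> borelRn R n) measurable.

Definition sigma_batch s k : set_system Omega := <<s batch_events s k >>.

(* sigma(x_0, xi^0, .., xi^(k-1), eta^0, .., eta^(k-1)) *)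
Definition filtF (x0 : Omega -> 'rV[R]_n) xis etas (k : nat) : set_system Omega :=
  <<s init_events x0 `|` \bigcup_(i < k) batch_events xis i
      `|` \bigcup_(i < k) batch_events etas i >>.

(* sigma(x_0, xi^0, .., xi^k, eta^0, .., eta^(k-1)) *)
Definition filtFhat (x0 : Omega -> 'rV[R]_n) xis etas (k : nat) : set_system Omega :=
  <<s init_events x0 `|` \bigcup_(i < k.+1) batch_events xis i
      `|` \bigcup_(i < k) batch_events etas i >>.

End filtrations.

Section anderson_seg.
Context {R : realType} {n : nat}.
Variables (X : set 'rV[R]_n) (gamma rho mu nu tau M : R).
Implicit Types (G Gxi Geta : 'rV[R]_n -> 'rV[R]_n) (x F Ft : 'rV[R]_n) (t theta : R).

Definition line_search_test G x t : bool :=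
  let y := proj X (x - t *: G x) in
  t * enorm (G x - G y) <= mu * enorm (x - y).

(* The first accepted trial step among gamma, gamma * rho, gamma * rho^2, ..
   If no trial step is accepted the search does not terminate and the value
   gamma is a placeholder; this cannot happen if G is Lipschitz. *)
Definition line_search_index G x : nat :=
  xget 0%N [set m | line_search_test G x (gamma * rho ^+ m) /\
    forall i, (i < m)%N -> ~~ line_search_test G x (gamma * rho ^+ i)].

Definition line_search_step G x : R := gamma * rho ^+ line_search_index G x.

Definition anderson_coef theta F Ft : R :=
  if enorm Ft < Num.min (enorm F) (nu * theta `^ (- tau))
  then dotv Ft (Ft - F) / enorm (Ft - F) ^+ 2
  else M + 1.

(* (x_k, theta_k) |-> (x_(k+1), theta_(k+1)) *)
Definition seg_step Gxi Geta (s : 'rV[R]_n * R) : 'rV[R]_n * R :=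
  let: (x, theta) := s in
  if proj X (x - gamma *: Gxi x) - x == 0 then (x, theta) else
  let t := line_search_step Gxi x in
  let yhalf := proj X (x - t *: Gxi x) in
  let y := proj X (x - t *: Geta yhalf) in
  let alpha := anderson_coef theta (yhalf - x) (y - x) in
  if `|alpha| <= M then (alpha *: x + (1 - alpha) *: y, theta + 1)
  else (y, theta).

Fixpoint seg_state (Hxi Heta : nat -> 'rV[R]_n -> 'rV[R]_n) (x0 : 'rV[R]_n)
    (k : nat) : 'rV[R]_n * R :=
  if k is j.+1 then seg_step (Hxi j) (Heta j) (seg_state Hxi Heta x0 j)
  else (x0, 1).

Definition seg_iterate Hxi Heta x0 k : 'rV[R]_n := (seg_state Hxi Heta x0 k).1.

End anderson_seg.

(* Main.v *)
Require Import Defs.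
From HB Require Import structures.
From mathcomp Require Import all_boot all_order all_algebra.
From mathcomp Require Import all_classical all_reals all_analysis.
From mathcomp Require Import measurable_realfun.
From mathcomp Require Import ring lra.

(** Fix a solution [z]. The extragradient inequality, in which the pseudomonotonicity of
    the mean operator [H] is used at the half step [yh], bounds the squared distance from
    the next point to [z] by the present one, minus a multiple of |x - yh|^2, plus
    errors caused by sampling ([extragradient_descent]). An accepted Anderson
    extrapolation keeps half of the descent, because its coefficient is below 1/2
    ([anderson_weight]), and costs at most a multiple of [theta `^ (- (2 * tau))]. Each
    such step increases [theta] by one and [1 < 2 * tau], so these costs have a finite
    sum ([theta_cost_summable]).

    If the sampling errors, relative to 1 + |x - z|^2, are summable along a trajectory, then
    the distances to every solution converge and x - yh tends to 0
    ([almost_decreasing_cvg]). The steps of the line search are bounded below, so every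
    cluster point is a solution, and the distance to it converges to 0
    ([quasi_fejer_cvg]). The residual is continuous and vanishes at a solution.

    It remains to see that the errors are almost surely summable. A batch that is
    independent of a random point [Y] evaluates the mean operator at [Y] with an error of
    second moment O(1 / S k), relative to the squared size of [Y]; as the sum of
    1 / sqrt (S k) is finite, the relative errors themselves have a finite sum of means and
    no martingale argument is needed ([batch_mean_summable]). This settles the error of the
    eta-batch at [yh], which depends on the past and on the xi-batch only.

    The error of the xi-batch at [yh] is correlated, since [yh] is computed from that batch.
    But the accepted step is one of the numbers [gamma * rho ^+ m], and after finitely many
    iterations only boundedly many values of [m] occur, as the mean over the batch of the
    Lipschitz constants converges. For each [m], the point [yh] differs from
    the projection of x - gamma rho^m H x, which depends on the past only, by at most the
    error of the batch at [x]. The correlated error is therefore bounded by uncorrelated ones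
    ([step_error_le]), without any uniform law of large numbers. *)

Set Implicit Arguments.
Unset Strict Implicit.
Unset Printing Implicit Defensive.

Import Order.TTheory GRing.Theory Num.Theory.
Import numFieldNormedType.Exports.

Local Open Scope classical_set_scope.
Local Open Scope ring_scope.

Local Notation proj := Defs.proj.

(** * Euclidean geometry and projections *)

Section inner_product.
Context {R : realType} {n : nat}.
Implicit Types (u v w : 'rV[R]_n) (a : R).

Lemma dotvC u v : dotv u v = dotv v u.
Proof. by apply: eq_bigr => i _; rewrite mulrC. Qed.

Lemma dotvDl u v w : dotv (u + v) w = dotv u w + dotv v w.
Proof. by rewrite -big_split; apply: eq_bigr => i _; rewrite mxE mulrDl. Qed.

Lemma dotvDr u v w : dotv w (u + v) = dotv w u + dotv w v.
Proof. by rewrite dotvC dotvDl !(dotvC w). Qed.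

Lemma dotvZl a u v : dotv (a *: u) v = a * dotv u v.
Proof. by rewrite mulr_sumr; apply: eq_bigr => i _; rewrite mxE mulrA. Qed.

Lemma dotvZr a u v : dotv u (a *: v) = a * dotv u v.
Proof. by rewrite dotvC dotvZl dotvC. Qed.

Lemma dotvNl u v : dotv (- u) v = - dotv u v.
Proof. by rewrite -scaleN1r dotvZl mulN1r. Qed.

Lemma dotvNr u v : dotv u (- v) = - dotv u v.
Proof. by rewrite dotvC dotvNl dotvC. Qed.

Lemma dotv0l u : dotv 0 u = 0.
Proof. by rewrite -(scale0r 0) dotvZl mul0r. Qed.

Definition dotvE := (dotvDl, dotvDr, dotvNl, dotvNr, dotvZl, dotvZr).

Lemma dotvv_ge0 u : 0 <= dotv u u.
Proof. by apply: sumr_ge0 => i _; rewrite -expr2 sqr_ge0. Qed.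

Lemma enorm_ge0 u : 0 <= enorm u.
Proof. exact: sqrtr_ge0. Qed.

Lemma enorm_sqr u : enorm u ^+ 2 = dotv u u.
Proof. by rewrite sqr_sqrtr// dotvv_ge0. Qed.

Lemma enorm0 : enorm (0 : 'rV[R]_n) = 0.
Proof. by rewrite /enorm dotv0l sqrtr0. Qed.

Lemma enormZ a u : enorm (a *: u) = `|a| * enorm u.
Proof.
by rewrite /enorm dotvZl dotvZr mulrA -expr2 sqrtrM ?sqr_ge0// sqrtr_sqr.
Qed.

Lemma enormN u : enorm (- u) = enorm u.
Proof. by rewrite -scaleN1r enormZ normrN normr1 mul1r. Qed.

Lemma enormB u v : enorm (u - v) = enorm (v - u).
Proof. by rewrite -enormN opprB. Qed.

Lemma coord_le_enorm u i : `|u 0 i| <= enorm u.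
Proof.
rewrite -(ler_pXn2r (n := 2)) ?nnegrE ?enorm_ge0// enorm_sqr.
rewrite -normrX ger0_norm ?sqr_ge0// /dotv (bigD1 i)//= -expr2 lerDl.
by apply: sumr_ge0 => j _; rewrite -expr2 sqr_ge0.
Qed.

Lemma enorm_eq0 u : enorm u = 0 -> u = 0.
Proof.
move=> u0; apply/rowP => i; rewrite mxE; apply/eqP; rewrite -normr_le0 -u0.
exact: coord_le_enorm.
Qed.

Lemma cauchy_schwarz u v : dotv u v <= enorm u * enorm v.
Proof.
have [u0|u0] := eqVneq (enorm u) 0; first by rewrite (enorm_eq0 u0) dotv0l enorm0 mul0r.
have [v0|v0] := eqVneq (enorm v) 0.
  by rewrite (enorm_eq0 v0) dotvC dotv0l enorm0 mulr0.
have := dotvv_ge0 (enorm v *: u - enorm u *: v).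
rewrite !dotvE -!enorm_sqr (dotvC v u).
have pu : 0 < enorm u by rewrite lt0r u0 enorm_ge0.
have pv : 0 < enorm v by rewrite lt0r v0 enorm_ge0.
have puv := mulr_gt0 pu pv.
move=> h; rewrite -(ler_pM2l puv); nra.
Qed.

Lemma enorm_sqrD u v : enorm (u + v) ^+ 2 = enorm u ^+ 2 + 2 * dotv u v + enorm v ^+ 2.
Proof. by rewrite !enorm_sqr !dotvE (dotvC v u); ring. Qed.

Lemma enorm_triangle u v : enorm (u + v) <= enorm u + enorm v.
Proof.
rewrite -(ler_pXn2r (n := 2)) ?nnegrE ?addr_ge0 ?enorm_ge0//.
by rewrite enorm_sqrD; have := cauchy_schwarz u v; nra.
Qed.

Lemma enorm_triangleB w u v : enorm (u - v) <= enorm (u - w) + enorm (w - v).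
Proof. by have := enorm_triangle (u - w) (w - v); rewrite addrA subrK. Qed.

Lemma enorm_dist u v : `|enorm u - enorm v| <= enorm (u - v).
Proof.
have := enorm_triangle (u - v) v; have := enorm_triangle (v - u) u.
by rewrite !subrK (enormB v u) ler_norml => *; apply/andP; split; lra.
Qed.

Lemma enorm_le_sum u : enorm u <= \sum_(i < n) `|u 0 i|.
Proof.
have s0 : 0 <= \sum_(i < n) `|u 0 i| by exact: sumr_ge0.
rewrite -(ler_pXn2r (n := 2)) ?nnegrE ?enorm_ge0// enorm_sqr expr2 mulr_suml.
apply: ler_sum => i _; apply: le_trans (ler_norm _) _; rewrite normrM.
by rewrite ler_wpM2l// (bigD1 i)//= lerDl sumr_ge0.
Qed.

Lemma norm_le_enorm u : `|u| <= enorm u.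
Proof.
rewrite /Num.norm/= mx_normrE; apply/bigmax_leP; split; first exact: enorm_ge0.
by case=> i j _ /=; rewrite ord1 coord_le_enorm.
Qed.

Lemma coord_le_norm u i : `|u 0 i| <= `|u|.
Proof.
rewrite [leRHS]mx_normrE.
exact: (le_bigmax_cond 0 (fun ij : 'I_1 * 'I_n => `|u ij.1 ij.2|) (j := (ord0, i))).
Qed.

Lemma enorm_le_norm u : enorm u <= n%:R * `|u|.
Proof.
apply: le_trans (enorm_le_sum u) _.
apply: (@le_trans _ _ (\sum_(i < n) `|u|)); first by apply: ler_sum => i _; exact: coord_le_norm.
by rewrite sumr_const card_ord mulr_natl.
Qed.

End inner_product.

Section topology.
Context {R : realType}.

Lemma cvg_enorm {n} {T : Type} {F : set_system T} {FF : Filter F} (f : T -> 'rV[R]_n)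
    (u : 'rV[R]_n) :
  f @ F --> u <-> (enorm (f x - u) @[x --> F]) --> 0.
Proof.
split=> [fu|fu].
  apply/cvgrPdist_lt => e e0.
  have n1 : 0 < n.+1%:R :> R by rewrite ltr0n.
  have /cvgrPdist_lt/(_ (e / n.+1%:R) (divr_gt0 e0 n1)) := fu.
  apply: filterS => x; rewrite ltr_pdivlMr// => xe.
  rewrite sub0r normrN ger0_norm ?enorm_ge0//.
  apply: le_lt_trans xe; rewrite enormB; apply: le_trans (enorm_le_norm _) _.
  by rewrite mulrC ler_wpM2l// ler_nat.
apply/cvgrPdist_lt => e e0; have /cvgrPdist_lt/(_ e e0) := fu.
apply: filterS => x; rewrite sub0r normrN ger0_norm ?enorm_ge0// => xe.
by apply: le_lt_trans xe; rewrite -normrN opprB norm_le_enorm.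
Qed.

Lemma lipschitz_continuousR {n} (f : 'rV[R]_n -> R) K :
  (forall x y, `|f x - f y| <= K * enorm (x - y)) -> continuous f.
Proof.
move=> fK u; apply/(@cvgrPdist_le _ _ _ (nbhs u) (nbhs_filter u) f) => e e0.
have : K * enorm (x - u) @[x --> nbhs u] --> 0.
  rewrite -(mulr0 K); apply: cvgMl_tmp.
  exact: (@cvg_enorm _ _ (nbhs u) (nbhs_filter u) id u).1 cvg_id.
move=> /(@cvgrPdist_le _ _ _ (nbhs u) (nbhs_filter u))/(_ e e0).
apply: filterS => x; rewrite sub0r normrN; apply: le_trans.
by rewrite distrC; apply: le_trans (fK _ _) (ler_norm _).
Qed.

Lemma enorm_continuous {n} : continuous (@enorm R n).
Proof.
by apply: (@lipschitz_continuousR _ _ 1) => x y; rewrite mul1r enorm_dist.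
Qed.

Lemma lipschitz_enorm_continuous {m n} (f : 'rV[R]_m -> 'rV[R]_n) K :
  (forall x y, enorm (f x - f y) <= K * enorm (x - y)) -> continuous f.
Proof.
move=> fK u; apply/(@cvg_enorm _ _ _ (nbhs_filter u) f).
apply: (@squeeze_cvgr _ _ (nbhs_filter u) _ (cst 0) (fun x => K * enorm (x - u))).
- by apply: nearW => x; rewrite /= enorm_ge0 fK.
- exact: cvg_cst.
- rewrite -(mulr0 K); apply: cvgMl_tmp.
  exact: (@cvg_enorm _ _ (nbhs u) (nbhs_filter u) id u).1 cvg_id.
Qed.

End topology.

Section projection.
Context {R : realType} {n : nat}.
Variable X : set 'rV[R]_n.
Hypotheses (X_closed : closed X) (X_convex : @convex_set R 'rV[R]_n X).
Hypothesis X_nonempty : X !=set0.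
Implicit Types x y p q v : 'rV[R]_n.

Lemma proj_exists x : exists p, is_proj X x p.
Proof.
have [q0 Xq0] := X_nonempty.
pose A := X `&` [set q | enorm (x - q) <= enorm (x - q0)].
have dist_cont : continuous (fun q => enorm (x - q)).
  apply: (@lipschitz_continuousR _ _ _ 1) => y z; rewrite mul1r.
  by apply: le_trans (enorm_dist _ _) _; rewrite opprB addrC addrA subrK enormB.
have A_compact : compact A.
  apply: bounded_closed_compact.
    exists (`|x| + enorm (x - q0)); split; first exact: num_real.
    move=> r lt_r q [_ /= xq]; apply: le_trans (ltW lt_r).
    have -> : q = x - (x - q) by rewrite opprB addrC subrK.
    apply: le_trans (ler_normB _ _) _; rewrite lerD2l.
    by apply: le_trans xq; exact: norm_le_enorm.
  apply: closedI => //.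
  apply: (@closed_comp _ _ (fun q => enorm (x - q)) [set r | r <= enorm (x - q0)]).
    by move=> q _; exact: dist_cont.
  exact: closed_le.
have A0 : A !=set0 by exists q0; split => //=.
have [p] := compact_EVT_min A0 A_compact (continuous_subspaceT dist_cont).
rewrite inE => -[Xp xp] pmin; exists p; split=> // q Xq.
have [xq|/ltW xq] := leP (enorm (x - q)) (enorm (x - q0)).
  by apply: pmin; rewrite inE; split.
exact: le_trans xq.
Qed.

Lemma proj_is_proj x : is_proj X x (proj X x).
Proof. exact: (@xgetPex _ 0 [set p | is_proj X x p] (proj_exists x)). Qed.

Lemma proj_in x : X (proj X x).
Proof. by have [] := proj_is_proj x. Qed.

Lemma convex_segment p q (t : R) : 0 <= t <= 1 -> X p -> X q ->
  X (p + t *: (q - p)).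
Proof.
move=> t01 Xp Xq; have := X_convex (Itv01 (andP t01).1 (andP t01).2) (mem_set Xq) (mem_set Xp).
rewrite inE; congr X; rewrite /conv/= scalerBr scalerBl scale1r.
by rewrite addrCA addrA.
Qed.

(** First-order optimality: no point of the segment from the projection to [q] is
    closer to [x], and the squared distance to [x] starts along that segment with
    slope minus twice this inner product. *)
Lemma proj_obtuse x q : X q -> dotv (x - proj X x) (q - proj X x) <= 0.
Proof.
move=> Xq; have [Xp pmin] := proj_is_proj x; set p := proj X x in Xp pmin *.
rewrite leNgt; apply/negP => a0; set a := dotv _ _ in a0.
have b0 : 0 <= dotv (q - p) (q - p) by exact: dotvv_ge0.
set b := dotv _ _ in b0.
(* the minimiser over t of |x - p - t (q - p)|^2, cut off at 1 *)
pose t := Num.min 1 (a / (b + 1)).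
have b1 : 0 < b + 1 by lra.
have t0 : 0 < t by rewrite lt_min ltr01 divr_gt0.
have t1 : t <= 1 by rewrite ge_min lexx.
have tb : t * (b + 1) <= a by rewrite -ler_pdivlMr// ge_min lexx orbT.
have /pmin : X (p + t *: (q - p)) by apply: convex_segment => //; rewrite (ltW t0).
rewrite -(ler_pXn2r (n := 2)) ?nnegrE ?enorm_ge0// opprD addrA [leRHS]enorm_sqrD.
by rewrite enormN !enorm_sqr dotvNr !dotvZr dotvZl -/a -/b; nra.
Qed.

Lemma proj_unique x p : X p -> (forall q, X q -> dotv (x - p) (q - p) <= 0) ->
  proj X x = p.
Proof.
move=> Xp pob; have := pob _ (proj_in x); have := proj_obtuse x Xp.
move: (proj X x) => r h1 h2.
apply/eqP; rewrite -subr_eq0; apply/eqP/enorm_eq0/eqP.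
rewrite -sqrf_eq0 enorm_sqr eq_le dotvv_ge0 andbT.
by move: h1 h2; rewrite !dotvE (dotvC r p); lra.
Qed.

Lemma proj_nonexpansive x y : enorm (proj X x - proj X y) <= enorm (x - y).
Proof.
have := proj_obtuse x (proj_in y); have := proj_obtuse y (proj_in x).
move: (proj X x) (proj X y) => p q h1 h2.
have h : dotv (p - q) (p - q) <= dotv (x - y) (p - q).
  by move: h1 h2; rewrite !dotvE (dotvC q p); lra.
have := le_trans h (cauchy_schwarz _ _); rewrite -enorm_sqr expr2.
have := enorm_ge0 (p - q); rewrite le_eqVlt => /predU1P[<- _|p0]; first exact: enorm_ge0.
by rewrite ler_pM2r.
Qed.

Lemma proj_continuous : continuous (proj X).
Proof.
by apply: (@lipschitz_enorm_continuous _ _ _ _ 1) => x y; rewrite mul1r proj_nonexpansive.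
Qed.

(** With step [t], a solution is a fixed point of the exact projection step; this is how
    distances of trial points to a solution are controlled by nonexpansiveness. *)
Lemma SOL_fixed H t z : 0 <= t -> SOL X H z -> proj X (z - t *: H z) = z.
Proof.
move=> t0 [Xz zsol]; apply: proj_unique => // q Xq.
by rewrite addrAC subrr add0r dotvNl dotvZl oppr_le0 mulr_ge0// zsol.
Qed.

End projection.

(** * Summable sequences *)

Section bounded_sums.
Context {R : realType}.
Implicit Types u v : nat -> R.

(** For nonnegative terms, boundedness of the partial sums is summability; it
    is stable under domination, scaling and reindexing without any limit. *)
Definition bounded_sums u := exists A : R, forall k, \sum_(i < k) u i <= A.

Lemma bounded_sumsD u v : bounded_sums u -> bounded_sums v ->
  bounded_sums (fun k => u k + v k).
Proof.
move=> [A uA] [B vB]; exists (A + B) => k.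
by rewrite big_split/=; apply: lerD; [exact: uA|exact: vB].
Qed.

Lemma bounded_sumsZ (c : R) u : 0 <= c -> bounded_sums u ->
  bounded_sums (fun k => c * u k).
Proof.
by move=> c0 [A uA]; exists (c * A) => k; rewrite -mulr_sumr ler_wpM2l.
Qed.

Lemma bounded_sums_sum (I : Type) (r : seq I) (u : nat -> I -> R) :
  (forall j, bounded_sums (fun k => u k j)) ->
  bounded_sums (fun k => \sum_(j <- r) u k j).
Proof.
move=> uA; elim: r => [|j r IH].
  by exists 0 => k; rewrite big1// => i _; rewrite big_nil.
have [A sA] := bounded_sumsD (uA j) IH; exists A => k.
by apply: le_trans (sA k); apply: ler_sum => i _; rewrite big_cons.
Qed.

Lemma bounded_sums_le u v : (forall k, u k <= v k) -> bounded_sums v ->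
  bounded_sums u.
Proof.
by move=> uv [A vA]; exists A => k; apply: le_trans (vA k); apply: ler_sum.
Qed.

Lemma bounded_sums_shift u N : (forall k, 0 <= u k) -> bounded_sums u ->
  bounded_sums (fun k => u (N + k)%N).
Proof.
move=> u0 [A uA]; exists A => k; apply: le_trans (uA (N + k)%N).
by rewrite big_split_ord/= lerDr sumr_ge0.
Qed.

Lemma bounded_sums_term u : (forall k, 0 <= u k) -> bounded_sums u ->
  exists2 A, 0 <= A & forall k, u k <= A.
Proof.
move=> u0 [A uA]; exists A; first by have := uA 0%N; rewrite big_ord0.
move=> k; apply: le_trans (uA k.+1); rewrite big_ord_recr/= lerDr.
exact: sumr_ge0.
Qed.

Lemma bounded_sums_cvg u : (forall k, 0 <= u k) -> bounded_sums u ->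
  cvgn (series u).
Proof.
move=> u0 [A uA]; apply: nondecreasing_is_cvgn.
  by apply: nondecreasing_series => k _ _; exact: u0.
by exists A => _ [k _ <-]; rewrite /series/= big_mkord.
Qed.

Lemma bounded_sums_cvg0 u : (forall k, 0 <= u k) -> bounded_sums u ->
  u @ \oo --> 0.
Proof. by move=> u0 uA; apply: cvg_series_cvg_0; exact: bounded_sums_cvg. Qed.

Lemma cvg_bounded_sums u : (forall k, 0 <= u k) -> cvgn (series u) ->
  bounded_sums u.
Proof.
move=> u0 cu; exists (limn (series u)) => k.
have nd : nondecreasing_seq (series u) by apply: nondecreasing_series.
by have := nondecreasing_cvgn_le nd cu k; rewrite /series/= big_mkord.
Qed.

(** Deterministic form of the Robbins-Siegmund lemma: the multiplicative
    perturbations only inflate the sequence by a bounded factor, after which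
    everything becomes an additive summable perturbation of a decreasing
    sequence. *)
Lemma almost_decreasing_cvg (a b c e : nat -> R) :
  (forall k, 0 <= a k) -> (forall k, 0 <= b k) -> (forall k, 0 <= c k) ->
  (forall k, 0 <= e k) ->
  (forall k, a k.+1 <= (1 + b k) * a k - c k + e k) ->
  bounded_sums b -> bounded_sums e ->
  [/\ cvgn a, c @ \oo --> 0 & exists B, forall k, a k <= B].
Proof.
move=> a0 b0 c0 e0 rec [B bB] [E eE].
pose A := (a 0%N + E) * expR B.
have aA k : a k <= A.
  have : a k <= (a 0%N + \sum_(i < k) e i) * expR (\sum_(i < k) b i).
    elim: k => [|k IH]; first by rewrite !big_ord0 addr0 expR0 mulr1.
    rewrite !big_ord_recr/= expRD.
    set s := \sum_(i < k) e i in IH *; set p := expR (\sum_(i < k) b i) in IH *.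
    have p1 : 1 <= p by rewrite -expR0 ler_expR sumr_ge0.
    have q1 : 1 + b k <= expR (b k) by exact: expR_ge1Dx.
    have s0 : 0 <= s by exact: sumr_ge0.
    have h1 : (1 + b k) * a k <= expR (b k) * ((a 0%N + s) * p).
      by apply: ler_pM => //; rewrite addr_ge0.
    have h2 : e k <= e k * (p * expR (b k)).
      rewrite ler_peMr//; have := b0 k; nra.
    have := rec k; have := c0 k; nra.
  move=> /le_trans; apply; apply: ler_pM; rewrite ?addr_ge0 ?sumr_ge0 ?expR_ge0//.
  - by rewrite lerD2l.
  - by rewrite ler_expR.
have A0 : 0 <= A by apply: le_trans (aA 0%N).
pose f k := b k * A + e k.
have f0 k : 0 <= f k by rewrite addr_ge0// mulr_ge0.
have fB : bounded_sums f.
  apply: bounded_sumsD; last by exists E.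
  by under eq_fun do rewrite mulrC; apply: bounded_sumsZ => //; exists B.
have cf := bounded_sums_cvg f0 fB.
have recf k : a k.+1 <= a k - c k + f k.
  by have := rec k; have := ler_wpM2l (b0 k) (aA k); rewrite /f; lra.
pose v k := a k - series f k.
have ca : cvgn a.
  have -> : a = (fun k => v k + series f k) by apply/funext => k; rewrite /v subrK.
  apply: is_cvgD => //; apply: nonincreasing_is_cvgn.
    apply/nonincreasing_seqP => k; rewrite /v/series/= big_nat_recr//=.
    by have := recf k; have := c0 k; lra.
  have [F fF] := fB; exists (- F) => _ [k _ <-].
  by rewrite /v/series/= big_mkord; have := a0 k; have := fF k; lra.
split => //; last by exists A.
apply: (@squeeze_cvgr _ _ _ _ (cst 0) (fun k => a k - a k.+1 + f k)).
- by apply: nearW => k; rewrite /= c0/=; have := recf k; lra.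
- exact: cvg_cst.
- have -> : (0 : R) = limn a - limn a + 0 by rewrite subrr addr0.
  apply: cvgD; last exact: bounded_sums_cvg0.
  by apply: cvgB => //; rewrite (@cvg_shiftS _ a).
Qed.

(** Integral comparison for [th `^ (- p)]: a sum over the values of a counter becomes a
    telescoping sum. The factor [2 `^ p] pays for replacing [th] by [th + 1]. *)
Lemma powR_le_increment (p th : R) : 1 < p -> 1 <= th ->
  th `^ (- p) <= 2 `^ p / (p - 1) * (th `^ (1 - p) - (th + 1) `^ (1 - p)).
Proof.
move=> p1 th1; have th0 : 0 < th by lra.
have th10 : 0 < th + 1 by lra.
have nz : th + 1 != 0 by rewrite gt_eqF.
have s0 : 0 < p - 1 by lra.
have -> : th `^ (1 - p) = (th + 1) `^ (1 - p) * ((th + 1) / th) `^ (p - 1).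
  rewrite powRM ?invr_ge0 ?(ltW th10) ?(ltW th0)// mulrA -powRD ?nz ?implybT//.
  rewrite subrKA subrr powRr0 mul1r -powR_inv1 ?(ltW th0)// -powRrM.
  by congr (_ `^ _); lra.
have h1 : 1 + (p - 1) / (th + 1) <= ((th + 1) / th) `^ (p - 1).
  rewrite /powR gt_eqF ?divr_gt0//; apply: le_trans (expR_ge1Dx _).
  rewrite lerD2l ler_wpM2l ?(ltW s0)//.
  rewrite -[(th + 1) / th]invrK lnV ?posrE ?invr_gt0 ?divr_gt0//.
  rewrite invf_div; have -> : th / (th + 1) = 1 + - (th + 1)^-1.
    by field; rewrite gt_eqF.
  rewrite lerNr; apply: le_ln1Dx.
  by rewrite ltrN2 invf_lt1//; lra.
have h2 : th `^ (- p) <= 2 `^ p * (th + 1) `^ (- p).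
  rewrite !powRN -ler_pdivrMl ?powR_gt0//.
  rewrite -invfM lef_pV2 ?posrE ?mulr_gt0 ?powR_gt0//.
  rewrite -powRM ?(ltW th0)//; apply: ge0_ler_powR; rewrite ?nnegrE; lra.
apply: le_trans h2 _; rewrite -[leRHS]mulrA ler_wpM2l ?powR_ge0//.
have h3 : (th + 1) `^ (- p) = (th + 1) `^ (1 - p) / (th + 1).
  rewrite -[X in _ / X]powRr1 ?(ltW th10)// -powRN -powRD ?nz ?implybT//.
  by congr (_ `^ _); lra.
rewrite h3 ler_pdivlMl//; have := powR_gt0 (1 - p) th10.
move: ((th + 1) `^ (1 - p)) (((th + 1) / th) `^ (p - 1)) h1 => q r h1 q0.
apply: (@le_trans _ _ (q * (1 + (p - 1) / (th + 1) - 1))).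
  by rewrite le_eqVlt; apply/orP; left; apply/eqP; ring.
by rewrite -[X in _ <= _ - X]mulr1 -mulrBr ler_wpM2l ?(ltW q0)// lerD2r.
Qed.

End bounded_sums.

(** * The extragradient inequality *)

Section one_step.
Context {R : realType} {n : nat}.
Variables (X : set 'rV[R]_n) (H : 'rV[R]_n -> 'rV[R]_n).
Hypotheses (X_closed : closed X) (X_convex : @convex_set R 'rV[R]_n X).
Hypothesis H_pseudomonotone : pseudomonotone X H.
Implicit Types (x y z F Ft : 'rV[R]_n) (Gxi Geta : 'rV[R]_n -> 'rV[R]_n).

Lemma enorm_sum3_sqr (u v w : 'rV[R]_n) :
  enorm (u + v + w) ^+ 2 <= 3 * enorm u ^+ 2 + 3 * enorm v ^+ 2 + 3 * enorm w ^+ 2.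
Proof.
have h := le_trans (enorm_triangle (u + v) w) (lerD (enorm_triangle u v) (lexx _)).
have := enorm_ge0 (u + v + w); move: h.
move: (enorm (u + v + w)) (enorm u) (enorm v) (enorm w) => s p q r h s0.
have : s ^+ 2 <= (p + q + r) ^+ 2 by rewrite lerXn2r ?nnegrE//; lra.
have := sqr_ge0 (p - q); have := sqr_ge0 (p - r); have := sqr_ge0 (q - r); lra.
Qed.

(** Pseudomonotonicity is only available for the exact operator, so both sampled
    operators are compared with it at the intermediate point [yh]. The line search
    controls the variation of [Gxi] between [x] and [yh]; this and the two sampling
    errors share the square of the displacement from [yh] to [y], whence the factors 3. *)
Lemma extragradient_descent Gxi Geta (mu t : R) x z :
  let yh := proj X (x - t *: Gxi x) in
  let y := proj X (x - t *: Geta yh) in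
  0 <= t -> SOL X H z ->
  t * enorm (Gxi x - Gxi yh) <= mu * enorm (x - yh) ->
  enorm (y - z) ^+ 2 <= enorm (x - z) ^+ 2 - (1 - 3 * mu ^+ 2) * enorm (x - yh) ^+ 2
    + 3 * (t * enorm (Gxi yh - H yh)) ^+ 2 + 3 * (t * enorm (Geta yh - H yh)) ^+ 2
    + 2 * t * enorm (Geta yh - H yh) * enorm (yh - z).
Proof.
move=> yh y t0 [Xz zsol] test.
have X0 : X !=set0 by exists z.
have Xyh : X yh by exact: proj_in.
have Xy : X y by exact: proj_in.
have h1 := proj_obtuse X_closed X_convex X0 (x - t *: Geta yh) Xz.
have h2 := proj_obtuse X_closed X_convex X0 (x - t *: Gxi x) Xy.
rewrite -/yh -/y in h1 h2; clearbody y yh.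
have h3 : 0 <= dotv (H yh) (yh - z) by apply: H_pseudomonotone => //; exact: zsol.
pose D := (Gxi x - Gxi yh) + (Gxi yh - H yh) + (H yh - Geta yh).
have h4 : t ^+ 2 * enorm D ^+ 2 <= 3 * mu ^+ 2 * enorm (x - yh) ^+ 2
    + 3 * (t * enorm (Gxi yh - H yh)) ^+ 2 + 3 * (t * enorm (Geta yh - H yh)) ^+ 2.
  have := ler_wpM2l (sqr_ge0 t) (enorm_sum3_sqr (Gxi x - Gxi yh) (Gxi yh - H yh) (H yh - Geta yh)).
  have : (t * enorm (Gxi x - Gxi yh)) ^+ 2 <= (mu * enorm (x - yh)) ^+ 2.
    have l0 : 0 <= t * enorm (Gxi x - Gxi yh) by rewrite mulr_ge0 ?enorm_ge0.
    by rewrite lerXn2r ?nnegrE//; exact: le_trans test.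
  by rewrite (enormB (H yh)) !exprMn; lra.
have h5 := ler_wpM2l t0 (cauchy_schwarz (Geta yh - H yh) (z - yh)).
rewrite (enormB z) in h5.
have h6 := ler_wpM2l t0 h3; rewrite mulr0 in h6.
have h7 := sqr_ge0 (enorm (t *: D - (y - yh))).
rewrite enorm_sqrD enormN enormZ exprMn (ger0_norm t0) dotvNr dotvZl in h7.
have DE : D = Gxi x - Geta yh by rewrite /D !addrA !subrK.
rewrite DE in h4 h7; clear DE D.
suff key : enorm (y - z) ^+ 2 <= enorm (x - z) ^+ 2 - enorm (x - yh) ^+ 2
    - enorm (y - yh) ^+ 2 + 2 * (t * dotv (Gxi x - Geta yh) (y - yh))
    + 2 * (t * dotv (Geta yh - H yh) (z - yh)) by lra.
move: h1 h2 h6; clear; rewrite !enorm_sqr !dotvE.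
rewrite (dotvC z y) (dotvC yh x) (dotvC z x) (dotvC yh y).
lra.
Qed.

(** As [Ft] is the shorter displacement, (F, F - Ft) - |F - Ft|^2 / 2 is
    (|F|^2 - |Ft|^2) / 2 > 0. An accepted extrapolation thus gives the new point at least
    half of the weight and keeps half of the descent. *)
Lemma anderson_weight F Ft : enorm Ft < enorm F ->
  2^-1 <= 1 - dotv Ft (Ft - F) / enorm (Ft - F) ^+ 2.
Proof.
move=> lt_F; have d0 : 0 < enorm (Ft - F) ^+ 2.
  rewrite exprn_gt0// lt0r enorm_ge0 andbT; apply: contraTN lt_F => /eqP/enorm_eq0/eqP.
  by rewrite subr_eq0 => /eqP ->; rewrite ltxx.
have lt_F2 : enorm Ft ^+ 2 < enorm F ^+ 2 by rewrite ltr_pXn2r// ?nnegrE enorm_ge0.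
suff : dotv Ft (Ft - F) / enorm (Ft - F) ^+ 2 <= 2^-1 by lra.
rewrite ler_pdivrMr//; move: lt_F2; rewrite enorm_sqrD enormN !enorm_sqr !dotvE.
by rewrite -?enorm_sqr; lra.
Qed.

Lemma affine_combination_sqr (al : R) x y z :
  enorm (al *: x + (1 - al) *: y - z) ^+ 2 =
  al * enorm (x - z) ^+ 2 + (1 - al) * enorm (y - z) ^+ 2
  - al * (1 - al) * enorm (y - x) ^+ 2.
Proof.
rewrite !enorm_sqr !dotvE (dotvC z x) (dotvC z y) (dotvC x y); ring.
Qed.

End one_step.

(** * Line search and descent of one iteration *)

Section descent.
Context {R : realType} {n : nat}.
Variables (X : set 'rV[R]_n) (H : 'rV[R]_n -> 'rV[R]_n).
Hypotheses (X_closed : closed X) (X_convex : @convex_set R 'rV[R]_n X).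
Hypothesis H_pseudomonotone : pseudomonotone X H.
Variables (gamma rho mu nu tau M : R).
Hypotheses (gamma_gt0 : 0 < gamma) (gamma_le1 : gamma <= 1).
Hypotheses (rho_gt0 : 0 < rho) (rho_lt1 : rho < 1) (mu_gt0 : 0 < mu).
Hypotheses (mu_lt : 3 * mu ^+ 2 < 1) (nu_ge0 : 0 <= nu) (M_gt0 : 0 < M).
Hypothesis tau_gt : 1 / 2 < tau.
Implicit Types (x y z : 'rV[R]_n) (G Gxi Geta : 'rV[R]_n -> 'rV[R]_n).

Local Notation lsindex := (line_search_index X gamma rho mu).
Local Notation lsstep := (line_search_step X gamma rho mu).

Lemma trial_step_gt0 m : 0 < gamma * rho ^+ m.
Proof. by rewrite mulr_gt0// exprn_gt0. Qed.

Lemma trial_step_le1 m : gamma * rho ^+ m <= 1.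
Proof. by rewrite mulr_ile1// ?(ltW gamma_gt0) ?exprn_ge0 ?exprn_ile1 ?ltW. Qed.

Lemma line_search_indexP G x m : line_search_test X mu G x (gamma * rho ^+ m) ->
  line_search_test X mu G x (lsstep G x) /\ (lsindex G x <= m)%N.
Proof.
move=> testm; pose acc k := line_search_test X mu G x (gamma * rho ^+ k).
have ex : exists k, acc k by exists m.
have [acc_i min_i] : [set k | acc k /\ forall i, (i < k)%N -> ~~ acc i] (lsindex G x).
  apply: (@xgetPex _ 0%N [set k | acc k /\ forall i, (i < k)%N -> ~~ acc i]).
  exists (ex_minn ex); case: ex_minnP => k acck mink; split=> // i ik.
  by apply: contraTN ik => /mink; rewrite -leqNgt.
by split=> //; rewrite leqNgt; apply/negP => /min_i; rewrite /acc testm.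
Qed.

Lemma line_search_lipschitz G (Lam : R) N :
  (forall x y, enorm (G x - G y) <= Lam * enorm (x - y)) ->
  gamma * rho ^+ N * Lam <= mu -> forall x, line_search_test X mu G x (gamma * rho ^+ N).
Proof.
move=> GL leN x; rewrite /line_search_test/=; set y := proj X _.
apply: le_trans (ler_wpM2l (ltW (trial_step_gt0 N)) (GL x y)) _.
by rewrite mulrA ler_wpM2r ?enorm_ge0.
Qed.

Lemma trial_step_small (Lam : R) : exists N, gamma * rho ^+ N * Lam <= mu.
Proof.
have [L0|L0] := leP Lam 0.
  exists 0%N; apply: (@le_trans _ _ 0); last exact: ltW.
  by rewrite mulr_ge0_le0// ltW// trial_step_gt0.
have cv : gamma * rho ^+ N * Lam @[N --> \oo] --> gamma * 0 * Lam.
  apply: cvgMr_tmp; apply: cvgMl_tmp; apply: cvg_expr.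
  by rewrite ger0_norm ?ltW.
rewrite mulr0 mul0r in cv; have /cvgrPdist_le/(_ mu mu_gt0)[N _ /(_ N (leqnn N))/=] := cv.
by rewrite sub0r normrN => h; exists N; exact: le_trans (ler_norm _) h.
Qed.

(** What the descent inequality at [z] loses because the operators are sampled. *)
Definition step_error Gxi Geta yh z : R :=
  3 * enorm (Gxi yh - H yh) ^+ 2 + 3 * enorm (Geta yh - H yh) ^+ 2
  + 2 * enorm (Geta yh - H yh) * enorm (yh - z).

Lemma step_error_ge0 Gxi Geta yh z : 0 <= step_error Gxi Geta yh z.
Proof.
by rewrite !addr_ge0 ?mulr_ge0 ?sqr_ge0 ?enorm_ge0.
Qed.

Lemma stopped_step G x : proj X (x - gamma *: G x) - x == 0 ->
  proj X (x - lsstep G x *: G x) = x.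
Proof.
rewrite subr_eq0 => /eqP stop.
have test0 : line_search_test X mu G x (gamma * rho ^+ 0).
  by rewrite /line_search_test/= expr0 mulr1 stop !subrr enorm0 !mulr0.
have [_] := line_search_indexP test0; rewrite leqn0 => /eqP i0.
by rewrite /line_search_step i0 expr0 mulr1.
Qed.

(** An extrapolated iterate may leave [X] and may be farther from [z] than both
    of the points that it combines; the excess is bounded by the squared threshold
    of the acceptance test, which is only charged when [theta] increases. *)
Lemma seg_step_descent Gxi Geta x th z :
  let t := lsstep Gxi x in
  let yh := proj X (x - t *: Gxi x) in
  let s := seg_step X gamma rho mu nu tau M Gxi Geta (x, th) in
  SOL X H z -> line_search_test X mu Gxi x t ->
  (s.2 = th \/ s.2 = th + 1) /\
  enorm (s.1 - z) ^+ 2 <= enorm (x - z) ^+ 2 - (1 - 3 * mu ^+ 2) / 2 * enorm (x - yh) ^+ 2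
   + (1 + M) * step_error Gxi Geta yh z
   + M * (1 + M) * nu ^+ 2 * ((s.2 - th) * th `^ (- (2 * tau))).
Proof.
move=> t yh s zsol test.
have M0 := M_gt0; have mu1 := mu_lt.
have E0 := step_error_ge0 Gxi Geta yh z.
have M1 : 0 <= 1 + M by lra.
have th2 : th `^ (- (2 * tau)) = (th `^ (- tau)) ^+ 2.
  by rewrite -powR_mulrn ?powR_ge0// -powRrM; congr (_ `^ _); lra.
rewrite th2; rewrite /s /seg_step; case: ifPn => [stop|_].
  split; first by left.
  rewrite /= /yh /t stopped_step// subrr !subrr enorm0 mul0r !mulr0 addr0.
  rewrite expr0n/= mulr0 subr0 lerDl mulr_ge0//.
  exact: step_error_ge0.
rewrite -/t -/yh; set y := proj X (x - t *: Geta yh).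
have t0 : 0 <= t by rewrite ltW// trial_step_gt0.
have t1 : t <= 1 by rewrite trial_step_le1.
set a := enorm (x - z) ^+ 2; set r := enorm (x - yh) ^+ 2.
set E := step_error _ _ _ _ in E0 *.
have r0 : 0 <= r by exact: sqr_ge0.
set c := 1 - 3 * mu ^+ 2; have c0 : 0 < c by rewrite /c; lra.
have desc : enorm (y - z) ^+ 2 <= a - c * r + E.
  apply: le_trans (extragradient_descent X_closed X_convex H_pseudomonotone Geta t0 zsol test) _.
  rewrite -/yh -/y -/a -/r -/c /E /step_error.
  have tt : t ^+ 2 <= 1 by rewrite exprn_ile1.
  have le_sqr (u : 'rV[R]_n) : (t * enorm u) ^+ 2 <= enorm u ^+ 2.
    by rewrite exprMn ler_piMl ?sqr_ge0.
  have le_prod (u : 'rV[R]_n) : 2 * t * enorm u * enorm (yh - z) <= 2 * enorm u * enorm (yh - z).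
    rewrite -!(mulrA 2) ler_pM2l// -mulrA ler_piMl// mulr_ge0 ?enorm_ge0//.
  have := le_sqr (Gxi yh - H yh); have := le_sqr (Geta yh - H yh).
  have := le_prod (Geta yh - H yh); clearbody c r a y yh t; lra.
have cr : 0 <= c * r by rewrite mulr_ge0 ?(ltW c0).
set al := anderson_coef _ _ _ _ _ _; case: ifPn => [al_le|_]; last first.
  split; first by left.
  rewrite /= subrr mul0r mulr0 addr0; apply: le_trans desc _.
  have : 0 <= M * E by rewrite mulr_ge0 ?(ltW M_gt0).
  by clearbody E r a c; lra.
split; first by right.
rewrite /=; have -> : th + 1 - th = 1 by rewrite addrAC subrr add0r.
rewrite mul1r.
have [alE lt_Ft] : al = dotv (y - x) ((y - x) - (yh - x)) / enorm ((y - x) - (yh - x)) ^+ 2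
    /\ enorm (y - x) < Num.min (enorm (yh - x)) (nu * th `^ (- tau)).
  move: al_le; rewrite /al /anderson_coef; case: ifP => [//|_].
  by rewrite ger0_norm; lra.
move: lt_Ft; rewrite lt_min => /andP[lt_F lt_th].
have w := anderson_weight lt_F; rewrite -alE in w.
have al_ge : - M <= al by move: al_le; rewrite ler_norml => /andP[].
rewrite affine_combination_sqr -/a.
have f2 : enorm (y - x) ^+ 2 <= nu ^+ 2 * (th `^ (- tau)) ^+ 2.
  by rewrite -exprMn lerXn2r ?nnegrE ?enorm_ge0 ?mulr_ge0 ?powR_ge0// ltW.
have f0 : 0 <= enorm (y - x) ^+ 2 by exact: sqr_ge0.
rewrite -(mulrA (M * (1 + M))); move: (nu ^+ 2 * _) f2 => q f2.
move: (enorm (y - x) ^+ 2) (enorm (y - z) ^+ 2) f0 f2 desc => f b f0 f2 desc.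
clearbody E a c r al; clear alE lt_F lt_th al_le test th2 zsol t0 t1 y s yh t.
have p1 : (1 - al) * b <= (1 - al) * (a - c * r + E) by rewrite ler_wpM2l//; lra.
have p2 : 0 <= (1 - al - 2^-1) * (c * r) by rewrite mulr_ge0//; lra.
have p3 : 0 <= (1 + M - (1 - al)) * E by rewrite mulr_ge0//; lra.
have p4 : - (al * (1 - al) * f) <= M * (1 + M) * q.
  have p5 : - (al * (1 - al)) <= M * (1 + M) by nra.
  have p6 : 0 <= M * (1 + M) by nra.
  apply: le_trans (ler_wpM2l p6 f2); rewrite -mulNr ler_wpM2r//.
lra.
Qed.

End descent.

(** * Stability of the sampling error *)

Section stability.
Context {R : realType} {n : nat}.
Variables (X : set 'rV[R]_n) (H : 'rV[R]_n -> 'rV[R]_n).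
Hypotheses (X_closed : closed X) (X_convex : @convex_set R 'rV[R]_n X).
Implicit Types (x y z xc xs : 'rV[R]_n) (G : 'rV[R]_n -> 'rV[R]_n).

(** The sampling noise of a Lipschitz operator grows linearly in [y]; divided by this
    linear weight it has moments that are bounded uniformly in [y]. *)
Definition rel_error G xc y : R := enorm (G y - H y) / (1 + enorm (y - xc)).

Lemma rel_error_ge0 G xc y : 0 <= rel_error G xc y.
Proof. by rewrite divr_ge0 ?addr_ge0 ?enorm_ge0. Qed.

Lemma rel_errorE G xc y :
  enorm (G y - H y) = rel_error G xc y * (1 + enorm (y - xc)).
Proof. by rewrite divfK// gt_eqF// ltr_wpDr ?enorm_ge0. Qed.

Lemma bounded_seq_cluster (u : nat -> 'rV[R]_n) z (B : R) :
  (forall k, enorm (u k - z) <= B) ->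
  exists xs, forall e : R, 0 < e -> forall N, exists2 k, (N <= k)%N & enorm (u k - xs) < e.
Proof.
move=> uB; pose A := [set y : 'rV[R]_n | enorm (y - z) <= B].
have A_compact : compact A.
  apply: bounded_closed_compact.
    exists (`|z| + B); split; first exact: num_real.
    move=> r lt_r y /= yz; apply: le_trans (ltW lt_r).
    rewrite -(subrK z y) addrC; apply: le_trans (ler_normD _ _) _; rewrite lerD2l.
    by apply: le_trans yz; exact: norm_le_enorm.
  apply: (@closed_comp _ _ (fun y => enorm (y - z)) [set r | r <= B]).
    move=> y _; apply: (@lipschitz_continuousR _ _ _ 1) => v w; rewrite mul1r.
    by apply: le_trans (enorm_dist _ _) _; rewrite opprB addrA subrK.
  exact: closed_le.
have uA : (u @ \oo) A by exists 0%N => // k _; exact: uB.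
have [xs [_ xs_cl]] := A_compact (u @ \oo) _ uA.
exists xs => e e0 N.
have tail : (u @ \oo) [set y | exists2 k, (N <= k)%N & y = u k].
  by exists N => // k /= Nk; exists k.
have ngb : nbhs xs [set y | enorm (y - xs) < e].
  have := (@cvg_enorm _ _ _ (nbhs xs) (nbhs_filter xs) id xs).1 cvg_id.
  move=> /(@cvgrPdist_lt _ _ _ (nbhs xs) (nbhs_filter xs))/(_ e e0).
  by apply: filterS => y; rewrite sub0r normrN ger0_norm ?enorm_ge0.
by have [_ [[k Nk ->] /= ?]] := xs_cl _ _ tail ngb; exists k.
Qed.

Variables (gamma rho Lam : R) (N : nat).
Hypotheses (gamma_gt0 : 0 < gamma) (gamma_le1 : gamma <= 1).
Hypotheses (rho_gt0 : 0 < rho) (rho_lt1 : rho < 1) (Lam_ge0 : 0 <= Lam).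
Hypothesis H_lip : forall x y, enorm (H x - H y) <= Lam * enorm (x - y).

(** The trial point that the exact operator would give. Unlike the accepted point
    of the line search it does not depend on the samples used by the search. *)
Definition ideal_point m x := proj X (x - (gamma * rho ^+ m) *: H x).

Lemma step_error_arith (A N0 : R) : 0 <= A -> 0 <= N0 ->
  exists2 K, 0 <= K & forall b D e e1 e2 e3 p q w : R, 0 <= b -> b <= A -> 0 <= D ->
    0 <= e -> 0 <= e3 -> 0 <= w ->
    e1 <= b * (1 + (D + N0)) -> e2 <= b * (1 + (q + N0)) -> q <= (1 + Lam) * D ->
    p <= e1 -> w <= p + q -> e <= Lam * p + e2 + Lam * p ->
    e3 <= b * (1 + (w + N0)) ->
    3 * e ^+ 2 + 3 * e3 ^+ 2 + 2 * e3 * w <= K * b * (1 + D ^+ 2).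
Proof.
move=> A0 N00; have L0 := Lam_ge0.
pose C := 1 + N0 + Lam; have C1 : 1 <= C by rewrite /C; lra.
have C0 : 0 <= C by lra.
have CN : 1 + N0 <= C by rewrite /C; lra.
have CL : 1 + 2 * Lam <= 2 * C by rewrite /C; lra.
have CD D : 0 <= D -> 1 + ((1 + Lam) * D + N0) <= C * (1 + D).
  by move=> D0; have := mulr_ge0 N00 D0; rewrite /C; lra.
clearbody C.
pose K1 := 2 * C * C; pose K2 := C * (2 + A).
have K10 : 0 <= K1 by rewrite /K1 !mulr_ge0.
have K20 : 0 <= K2 by rewrite /K2 mulr_ge0//; lra.
pose K := 3 * K1 ^+ 2 * A + 3 * K2 ^+ 2 * A + 2 * (K2 * K2).
have K0 : 0 <= K.
  have := mulr_ge0 (sqr_ge0 K1) A0; have := mulr_ge0 (sqr_ge0 K2) A0.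
  by have := mulr_ge0 K20 K20; rewrite /K; clearbody K1 K2; lra.
exists (2 * K); first by rewrite mulr_ge0.
move=> b D e e1 e2 e3 p q w b0 bA D0 e0 e30 w0 he1 he2 hq hp hw he he3.
pose s := 1 + D; have s0 : 0 <= s by rewrite /s; lra.
have LD : 0 <= Lam * D by rewrite mulr_ge0.
have Cs := CD D D0; rewrite -/s in Cs.
have h1 : e1 <= b * (C * s).
  by apply: le_trans he1 _; rewrite ler_wpM2l//; lra.
have h2 : e2 <= b * (C * s).
  by apply: le_trans he2 _; rewrite ler_wpM2l//; lra.
have bC : b * (C * s) <= A * (C * s) by rewrite ler_wpM2r// mulr_ge0.
have Cs0 : 0 <= C * s by rewrite mulr_ge0.
have K2s : K2 * s = 2 * (C * s) + A * (C * s) by rewrite /K2; ring.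
have hw' : w <= K2 * s by lra.
have he' : e <= K1 * b * s.
  have := ler_wpM2l L0 (le_trans hp h1).
  have : (1 + 2 * Lam) * (b * (C * s)) <= 2 * C * (b * (C * s)).
    by rewrite ler_wpM2r// mulr_ge0.
  have -> : K1 * b * s = 2 * C * (b * (C * s)) by rewrite /K1; ring.
  lra.
have he3' : e3 <= K2 * b * s.
  apply: le_trans he3 _; rewrite (mulrC K2) -mulrA ler_wpM2l//; lra.
have sq (f c : R) : 0 <= f -> 0 <= c -> f <= c * b * s -> f ^+ 2 <= c ^+ 2 * A * b * s ^+ 2.
  move=> f0 c0 fc; apply: (@le_trans _ _ ((c * b * s) ^+ 2)).
    by rewrite lerXn2r ?nnegrE// !mulr_ge0.
  rewrite !exprMn ler_wpM2r ?sqr_ge0// -mulrA ler_wpM2l ?sqr_ge0//.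
  by rewrite expr2 ler_wpM2r.
have s1 := sq _ _ e0 K10 he'.
have s2 := sq _ _ e30 K20 he3'.
have s3 : e3 * w <= (K2 * b * s) * (K2 * s) by apply: ler_pM.
have s4 : s ^+ 2 <= 2 * (1 + D ^+ 2) by rewrite /s; have := sqr_ge0 (1 - D); lra.
have -> : 2 * K * b * (1 + D ^+ 2) = K * b * (2 * (1 + D ^+ 2)) by ring.
have := ler_wpM2l (mulr_ge0 K0 b0) s4; apply: le_trans.
by rewrite /K; clearbody K1 K2 s; lra.
Qed.

(** The accepted point depends on the samples at which its error is measured, but
    only through the finitely many values of the step and through the sampled
    operator at [x]. Replacing it by the ideal trial point moves it by at most the
    error at [x], which by Lipschitz continuity costs a multiple of that error. *)
Lemma step_error_le xc z (A : R) : SOL X H z -> 0 <= A ->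
  exists2 C, 0 <= C & forall Gxi Geta x m b,
    (forall x y, enorm (Gxi x - Gxi y) <= Lam * enorm (x - y)) ->
    let yh := proj X (x - (gamma * rho ^+ m) *: Gxi x) in
    rel_error Gxi xc x <= b -> rel_error Gxi xc (ideal_point m x) <= b ->
    rel_error Geta xc yh <= b -> b <= A ->
    step_error H Gxi Geta yh z <= C * b * (1 + enorm (x - z) ^+ 2).
Proof.
move=> zsol A0; have X0 : X !=set0 by exists z; case: zsol.
have [K K0 arith] := step_error_arith A0 (enorm_ge0 (z - xc)).
exists K => // Gxi Geta x m b GL yh b1 b2 b3 bA.
have b0 : 0 <= b := le_trans (rel_error_ge0 _ _ _) b1.
have t0 : 0 <= gamma * rho ^+ m by rewrite ltW// trial_step_gt0.
have t1 : gamma * rho ^+ m <= 1 by rewrite trial_step_le1.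
set t := gamma * rho ^+ m in t0 t1 yh b3 *.
set yb := ideal_point m x in b2.
have err G y : rel_error G xc y <= b ->
    enorm (G y - H y) <= b * (1 + (enorm (y - z) + enorm (z - xc))).
  move=> yb_le; rewrite (rel_errorE _ xc).
  apply: ler_pM; rewrite ?rel_error_ge0 ?addr_ge0 ?enorm_ge0//.
  by rewrite lerD2l enorm_triangleB.
apply: (arith b (enorm (x - z)) _ (enorm (Gxi x - H x)) (enorm (Gxi yb - H yb)) _
  (enorm (yh - yb)) (enorm (yb - z))); rewrite ?enorm_ge0 ?err//.
- rewrite -[z in yb - z](SOL_fixed X_closed X_convex X0 t0 zsol).
  apply: le_trans (proj_nonexpansive X_closed X_convex X0 _ _) _.
  have -> : x - t *: H x - (z - t *: H z) = (x - z) - t *: (H x - H z).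
    by rewrite scalerBr !opprB addrACA [RHS]addrACA; congr (_ + _); exact: addrC.
  apply: le_trans (enorm_triangle _ _) _.
  rewrite enormN enormZ ger0_norm// mulrDl mul1r lerD2l.
  by apply: le_trans (H_lip x z); rewrite ler_piMl ?enorm_ge0.
- apply: le_trans (proj_nonexpansive X_closed X_convex X0 _ _) _.
  have -> : x - t *: Gxi x - (x - t *: H x) = - (t *: (Gxi x - H x)).
    by rewrite scalerBr !opprB addrC addrA subrK.
  by rewrite enormN enormZ ger0_norm// ler_piMl ?enorm_ge0.
- exact: enorm_triangleB.
- have -> : Gxi yh - H yh = (Gxi yh - Gxi yb) + (Gxi yb - H yb) + (H yb - H yh).
    by rewrite !addrA !subrK.
  apply: le_trans (enorm_triangle _ _) _; apply: lerD.
    by apply: le_trans (enorm_triangle _ _) _; rewrite lerD2r GL.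
  by rewrite (enormB yh) H_lip.
Qed.

End stability.

(** * Convergence along a trajectory *)

Section path_convergence.
Context {R : realType} {n : nat}.
Variables (X : set 'rV[R]_n) (H : 'rV[R]_n -> 'rV[R]_n).
Hypotheses (X_closed : closed X) (X_convex : @convex_set R 'rV[R]_n X).
Variable Lam : R.
Hypotheses (Lam_ge0 : 0 <= Lam).
Hypothesis H_lip : forall x y, enorm (H x - H y) <= Lam * enorm (x - y).
Implicit Types (x yh : nat -> 'rV[R]_n) (z xc : 'rV[R]_n).

(** A quasi-Fejer argument: one solution gives boundedness, every cluster point is
    a solution, and the distance to that cluster point converges, hence to 0. *)
Lemma quasi_fejer_cvg x yh (g : nat -> 'rV[R]_n) (b : nat -> R) xc (c kappa : R) :
  0 < c -> 0 <= kappa -> SOL X H !=set0 ->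
  (forall k, 0 <= b k) -> bounded_sums b ->
  (forall z, SOL X H z -> exists (C : R) (e : nat -> R),
     [/\ 0 <= C, forall k, 0 <= e k, bounded_sums e &
     forall k, enorm (x k.+1 - z) ^+ 2 <= (1 + C * b k) * enorm (x k - z) ^+ 2
       - c * enorm (x k - yh k) ^+ 2 + e k]) ->
  (forall k, X (yh k)) ->
  (forall k q, X q -> dotv (g k) (yh k - q) <= kappa * enorm (x k - yh k) * enorm (q - yh k)) ->
  (forall k, enorm (g k - H (x k)) <= b k * (1 + enorm (x k - xc))) ->
  exists2 xs, SOL X H xs & x @ \oo --> xs.
Proof.
move=> c0 kappa0 [z0 z0sol] b0 bB desc Xyh var err.
have L0 := Lam_ge0.
have apply_desc z : SOL X H z -> [/\ cvgn (fun k => enorm (x k - z) ^+ 2),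
    (fun k => c * enorm (x k - yh k) ^+ 2) @ \oo --> 0 &
    exists B, forall k, enorm (x k - z) ^+ 2 <= B].
  move=> /desc[C [e [C0 e0 eB rec]]].
  apply: (@almost_decreasing_cvg _ _ (fun k => C * b k) _ e) => //.
  - by move=> k; exact: sqr_ge0.
  - by move=> k; rewrite mulr_ge0.
  - by move=> k; rewrite mulr_ge0 ?sqr_ge0 ?ltW.
  - exact: bounded_sumsZ.
have [_ cr [B aB]] := apply_desc _ z0sol.
have xB k : enorm (x k - z0) <= B + 1.
  have := aB k; have := sqr_ge0 (enorm (x k - z0) - 1); have := sqr_ge0 (enorm (x k - z0)).
  by move: (enorm _) => u; lra.
have [xs xs_cl] := bounded_seq_cluster xB.
have r_small (e : R) : 0 < e -> exists K, forall k, (K <= k)%N -> enorm (x k - yh k) < e.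
  move=> e0; have ce : 0 < c * e ^+ 2 by rewrite mulr_gt0 ?exprn_gt0.
  have /cvgrPdist_lt/(_ (c * e ^+ 2) ce)[K _ Kr] := cr; exists K => k /Kr/=.
  rewrite sub0r normrN ger0_norm; last by rewrite mulr_ge0 ?sqr_ge0 ?(ltW c0).
  by rewrite ltr_pM2l// ltr_pXn2r ?nnegrE ?enorm_ge0 ?(ltW e0).
have g_small : forall e : R, 0 < e -> exists K, forall k, (K <= k)%N -> enorm (g k - H (x k)) < e.
  move=> e e0; pose B' := 1 + (B + 1 + enorm (z0 - xc)).
  have B'0 : 0 < B'.
    by have := le_trans (enorm_ge0 _) (xB 0%N); have := enorm_ge0 (z0 - xc); rewrite /B'; lra.
  have /cvgrPdist_lt/(_ (e / B') (divr_gt0 e0 B'0))[K _ Kb] := bounded_sums_cvg0 b0 bB.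
  exists K => k /Kb/=; rewrite sub0r normrN ger0_norm// ltr_pdivlMr//.
  apply: le_lt_trans; apply: le_trans (err k) _; rewrite ler_wpM2l// lerD2l.
  by apply: le_trans (enorm_triangleB z0 _ _) _; rewrite lerD2r.
have close (e : R) : 0 < e -> exists k, [/\ enorm (x k - xs) < e, enorm (x k - yh k) < e &
    enorm (g k - H (x k)) < e].
  move=> e0; have [K1 h1] := r_small e e0; have [K2 h2] := g_small e e0.
  have [k Kk xk] := xs_cl e e0 (maxn K1 K2); exists k; split => //.
  - by apply: h1; apply: leq_trans Kk; exact: leq_maxl.
  - by apply: h2; apply: leq_trans Kk; exact: leq_maxr.
have yh_xs k (e : R) : enorm (x k - xs) < e -> enorm (x k - yh k) < e -> enorm (yh k - xs) < 2 * e.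
  move=> h1 h2; apply: le_lt_trans (enorm_triangleB (x k) _ _) _.
  by rewrite (enormB (yh k)); lra.
have xs_sol : SOL X H xs.
  split.
    rewrite (closure_id X).1// => U Uxs.
    have /nbhs_ballP[e /= e0 eU] : nbhs xs U by [].
    have [k [h1 h2 _]] := close (e / 2) (divr_gt0 e0 (ltr0Sn _ _)).
    exists (yh k); split; first exact: Xyh.
    apply: eU; rewrite -ball_normE/=; apply: le_lt_trans (norm_le_enorm _) _.
    by rewrite enormB; have := yh_xs _ _ h1 h2; rewrite mulrC divfK.
  move=> q Xq; rewrite leNgt; apply/negP => neg.
  pose Q := enorm (q - xs) + 2; have Q0 : 0 < Q by have := enorm_ge0 (q - xs); rewrite /Q; lra.
  have h0 := enorm_ge0 (H xs); set h := enorm (H xs) in h0.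
  pose K := kappa * Q + (Lam + 1) * Q + 2 * h + 1.
  have K0 : 0 < K.
    have := mulr_ge0 kappa0 (ltW Q0); have := mulr_ge0 L0 (ltW Q0); rewrite /K; lra.
  set v := dotv _ _ in neg.
  pose e := Num.min 1 (- v / K).
  have e0 : 0 < e by rewrite lt_min ltr01 divr_gt0// oppr_gt0.
  have e1 : e <= 1 by rewrite ge_min lexx.
  have eK : e * K <= - v by rewrite -ler_pdivlMr// ge_min lexx orbT.
  have [k [x_xs x_yh g_H]] := close e e0.
  have y_xs := yh_xs _ _ x_xs x_yh.
  have y_q : enorm (q - yh k) <= Q.
    by apply: le_trans (enorm_triangleB xs _ _) _; rewrite (enormB xs) /Q; lra.
  have vE : - v = dotv (g k) (yh k - q) + dotv (H xs - g k) (yh k - q) + dotv (H xs) (xs - yh k).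
    by rewrite /v !dotvE; ring.
  have t1 : dotv (g k) (yh k - q) <= kappa * Q * e.
    apply: le_trans (var k q Xq) _; rewrite -!mulrA ler_wpM2l// mulrC.
    by apply: ler_pM; rewrite ?enorm_ge0// ltW.
  have t2 : dotv (H xs - g k) (yh k - q) <= (Lam + 1) * Q * e.
    apply: le_trans (cauchy_schwarz _ _) _; rewrite (enormB (yh k)) mulrAC.
    apply: ler_pM; rewrite ?enorm_ge0//.
    apply: le_trans (enorm_triangleB (H (x k)) _ _) _.
    have := H_lip xs (x k); rewrite (enormB (H (x k))) (enormB xs (x k)).
    have := ler_wpM2l L0 (ltW x_xs); lra.
  have t3 : dotv (H xs) (xs - yh k) <= 2 * h * e.
    apply: le_trans (cauchy_schwarz _ _) _; rewrite -/h (enormB xs).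
    by rewrite (mulrC 2) -mulrA ler_wpM2l// ltW.
  have : e * K = kappa * Q * e + (Lam + 1) * Q * e + 2 * h * e + e by rewrite /K; ring.
  lra.
exists xs => //; apply/cvg_enorm.
have [ca _ _] := apply_desc _ xs_sol.
have lim0 : limn (fun k => enorm (x k - xs) ^+ 2) = 0.
  set l := limn _; have l_ge0 : 0 <= l.
    by apply: limr_ge => //; apply: nearW => k; exact: sqr_ge0.
  apply/eqP; rewrite eq_le l_ge0 andbT leNgt; apply/negP => l0.
  have /cvgrPdist_lt/(_ (l / 2) (divr_gt0 l0 (ltr0Sn _ _)))[K _ Ka] := ca.
  have e0 : 0 < Num.min 1 (l / 2) by rewrite lt_min ltr01 divr_gt0.
  have [k Kk xk] := xs_cl _ e0 K; have := Ka k Kk => /=.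
  rewrite -/l ltr_distlC => /andP[+ _]; move: xk; rewrite lt_min => /andP[x1 x2].
  have := enorm_ge0 (x k - xs); move: (enorm _) x1 x2 => u x1 x2 u0.
  have : u ^+ 2 <= u by rewrite expr2 ler_piMl// ltW.
  by lra.
rewrite /= in ca; have {}ca : (fun k => enorm (x k - xs) ^+ 2) @ \oo --> 0 by rewrite -lim0.
apply/cvgrPdist_lt => e e0.
have /cvgrPdist_lt/(_ (e ^+ 2) (exprn_gt0 2 e0))[K _ Ka] := ca.
exists K => // k /Ka/=; rewrite !sub0r !normrN !ger0_norm ?enorm_ge0 ?sqr_ge0//.
by rewrite ltr_pXn2r ?nnegrE ?enorm_ge0 ?(ltW e0).
Qed.

Lemma residual_cvg0 (gamma : R) x xs : 0 <= gamma -> SOL X H xs -> x @ \oo --> xs ->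
  (fun k => residual X H gamma (x k)) @ \oo --> 0.
Proof.
move=> g0 xs_sol /cvg_enorm xxs; have X0 : X !=set0 by exists xs; case: xs_sol.
apply: (@squeeze_cvgr _ _ _ _ (cst 0) (fun k => (2 + gamma * Lam) * enorm (x k - xs))).
- apply: nearW => k; rewrite /= enorm_ge0/= /residual.
  set p := proj X _; have pE := SOL_fixed X_closed X_convex X0 g0 xs_sol.
  apply: le_trans (enorm_triangleB xs _ _) _.
  rewrite -{1}pE (enormB xs (x k)).
  have := proj_nonexpansive X_closed X_convex X0 (x k - gamma *: H (x k)) (xs - gamma *: H xs).
  rewrite -/p; have -> : x k - gamma *: H (x k) - (xs - gamma *: H xs) =
      (x k - xs) - gamma *: (H (x k) - H xs).
    by rewrite scalerBr !opprB addrACA [RHS]addrACA; congr (_ + _); exact: addrC.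
  have := enorm_triangle (x k - xs) (- (gamma *: (H (x k) - H xs))).
  rewrite enormN enormZ ger0_norm//.
  have := ler_wpM2l g0 (H_lip (x k) xs).
  lra.
- exact: cvg_cst.
- by rewrite -(mulr0 (2 + gamma * Lam)); exact: cvgMl_tmp.
Qed.

End path_convergence.

Section seg_path.
Context {R : realType} {n : nat}.
Variables (X : set 'rV[R]_n) (H : 'rV[R]_n -> 'rV[R]_n).
Hypotheses (X_closed : closed X) (X_convex : @convex_set R 'rV[R]_n X).
Hypotheses (H_pseudomonotone : pseudomonotone X H) (SOL_nonempty : SOL X H !=set0).
Variables (gamma rho mu nu tau M Lam : R).
Hypotheses (gamma_gt0 : 0 < gamma) (gamma_le1 : gamma <= 1).
Hypotheses (rho_gt0 : 0 < rho) (rho_lt1 : rho < 1) (mu_gt0 : 0 < mu).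
Hypotheses (mu_lt : 3 * mu ^+ 2 < 1) (nu_ge0 : 0 <= nu) (M_gt0 : 0 < M).
Hypothesis tau_gt : 1 / 2 < tau.
Hypothesis Lam_ge0 : 0 <= Lam.
Hypothesis H_lip : forall x y, enorm (H x - H y) <= Lam * enorm (x - y).

Lemma seg_state_theta_ge1 Hxi Heta x0 k :
  1 <= (seg_state X gamma rho mu nu tau M Hxi Heta x0 k).2.
Proof.
elim: k => [|k IH]; first by rewrite /= lexx.
rewrite /=; case: seg_state IH => x th /= th1; rewrite /seg_step.
by case: ifP => //= _; case: ifP => //= _; lra.
Qed.

(** Each accepted extrapolation increases [theta] by one, so its cost is paid by the
    telescoping increments of a negative power of [theta]; the exponent is
    negative because [1 < 2 * tau]. *)
Lemma theta_cost_summable (th : nat -> R) : (forall k, 1 <= th k) ->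
  (forall k, th k.+1 = th k \/ th k.+1 = th k + 1) ->
  bounded_sums (fun k => (th k.+1 - th k) * th k `^ (- (2 * tau))).
Proof.
move=> th1 step; have p1 : 1 < 2 * tau by have := tau_gt; lra.
pose C := 2 `^ (2 * tau) / (2 * tau - 1).
have C0 : 0 <= C by rewrite divr_ge0 ?powR_ge0//; lra.
exists (C * th 0%N `^ (1 - 2 * tau)) => k.
apply: (@le_trans _ _ (C * (th 0%N `^ (1 - 2 * tau) - th k `^ (1 - 2 * tau)))); last first.
  by rewrite ler_wpM2l// gerBl powR_ge0.
elim: k => [|k IH]; first by rewrite big_ord0 subrr mulr0.
rewrite big_ord_recr/=; apply: le_trans (lerD IH (lexx _)) _.
have [->|->] := step k; first by rewrite subrr mul0r addr0.
have := powR_le_increment p1 (th1 k); rewrite -/C.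
have -> : th k + 1 - th k = 1 by rewrite addrAC subrr add0r.
rewrite mul1r; lra.
Qed.

(** The whole argument along one trajectory. From iteration [K0] on the sampled operators
    share a Lipschitz constant, hence the line search stops within [N] trials and at most
    [N.+1] ideal points per iteration enter the error bound. *)
Lemma seg_path_cvg Hxi Heta x0 xc K0 :
  let x k := seg_iterate X gamma rho mu nu tau M Hxi Heta x0 k in
  let yh k := proj X (x k - line_search_step X gamma rho mu (Hxi k) (x k) *: Hxi k (x k)) in
  (forall k, (K0 <= k)%N -> forall u v, enorm (Hxi k u - Hxi k v) <= Lam * enorm (u - v)) ->
  bounded_sums (fun k => rel_error H (Hxi k) xc (x k)) ->
  (forall m, bounded_sums (fun k => rel_error H (Hxi k) xc (ideal_point X H gamma rho m (x k)))) ->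
  bounded_sums (fun k => rel_error H (Heta k) xc (yh k)) ->
  (exists2 xs, SOL X H xs & x @ \oo --> xs) /\
  (fun k => residual X H gamma (x k)) @ \oo --> 0.
Proof.
move=> x yh Hxi_lip sum_x sum_ideal sum_yh.
have X0 : X !=set0 by have [z [Xz _]] := SOL_nonempty; exists z.
suff cv : exists2 xs, SOL X H xs & x @ \oo --> xs.
  split=> //; have [xs xs_sol x_xs] := cv.
  exact: (residual_cvg0 X_closed X_convex H_lip (ltW gamma_gt0) xs_sol x_xs).
have [N stepN] := trial_step_small gamma_gt0 rho_gt0 rho_lt1 mu_gt0 Lam.
pose m k := line_search_index X gamma rho mu (Hxi k) (x k).
have ls k : (K0 <= k)%N -> line_search_test X mu (Hxi k) (x k) (gamma * rho ^+ m k) /\ (m k <= N)%N.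
  move=> /Hxi_lip lip.
  have tN := line_search_lipschitz X gamma_gt0 rho_gt0 lip stepN (x k).
  exact: line_search_indexP tN.
pose b k := rel_error H (Hxi k) xc (x k)
  + \sum_(j < N.+1) rel_error H (Hxi k) xc (ideal_point X H gamma rho j (x k))
  + rel_error H (Heta k) xc (yh k).
have s0 k : 0 <= \sum_(j < N.+1) rel_error H (Hxi k) xc (ideal_point X H gamma rho j (x k)).
  by apply: sumr_ge0 => j _; exact: rel_error_ge0.
have b0 k : 0 <= b k by rewrite !addr_ge0 ?rel_error_ge0.
have bB : bounded_sums b.
  apply: bounded_sumsD => //; apply: bounded_sumsD => //.
  apply: (@bounded_sums_sum _ _ _ (fun k (j : 'I_N.+1) =>
    rel_error H (Hxi k) xc (ideal_point X H gamma rho j (x k)))) => j.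
  exact: sum_ideal.
have [A A0 bA] := bounded_sums_term b0 bB.
have b_x k : rel_error H (Hxi k) xc (x k) <= b k.
  by have := s0 k; have := rel_error_ge0 H (Heta k) xc (yh k); rewrite /b; lra.
have b_ideal k : (K0 <= k)%N ->
    rel_error H (Hxi k) xc (ideal_point X H gamma rho (m k) (x k)) <= b k.
  move=> /ls[_ mN]; rewrite /b -addrA addrCA addrA -addrA.
  rewrite (bigD1 (Ordinal (mN : (m k < N.+1)%N)))//= -addrA lerDl !addr_ge0 ?rel_error_ge0//.
  by apply: sumr_ge0 => j _; exact: rel_error_ge0.
have b_yh k : rel_error H (Heta k) xc (yh k) <= b k.
  by have := s0 k; have := rel_error_ge0 H (Hxi k) xc (x k); rewrite /b; lra.
pose th k := (seg_state X gamma rho mu nu tau M Hxi Heta x0 k).2.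
pose w k := (th k.+1 - th k) * th k `^ (- (2 * tau)).
have stateE k : seg_state X gamma rho mu nu tau M Hxi Heta x0 k = (x k, th k).
  by rewrite /x /th /seg_iterate; case: seg_state.
have M0 := M_gt0; have mu1 := mu_lt.
have desc k z : (K0 <= k)%N -> SOL X H z -> (th k.+1 = th k \/ th k.+1 = th k + 1) /\
    enorm (x k.+1 - z) ^+ 2 <= enorm (x k - z) ^+ 2
      - (1 - 3 * mu ^+ 2) / 2 * enorm (x k - yh k) ^+ 2
      + (1 + M) * step_error H (Hxi k) (Heta k) (yh k) z + M * (1 + M) * nu ^+ 2 * w k.
  move=> /ls[test _] zsol.
  have [hth hx] := seg_step_descent X_closed X_convex H_pseudomonotone tau gamma_gt0 gamma_le1
     rho_gt0 rho_lt1 mu_lt nu_ge0 M_gt0 (Heta k) (th k) zsol test.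
  have step1 : x k.+1 = (seg_step X gamma rho mu nu tau M (Hxi k) (Heta k) (x k, th k)).1.
    by rewrite -stateE.
  rewrite /w step1.
  rewrite (_ : th k.+1 = (seg_step X gamma rho mu nu tau M (Hxi k) (Heta k) (x k, th k)).2) //.
  by rewrite -stateE.
have th1 k : 1 <= th k by exact: seg_state_theta_ge1.
have w0 k : (K0 <= k)%N -> 0 <= w k.
  have [z zsol] := SOL_nonempty; move=> /desc/(_ zsol)[hth _].
  by rewrite /w mulr_ge0 ?powR_ge0// subr_ge0; case: hth => ->; lra.
have K0k k : (K0 <= K0 + k)%N by exact: leq_addr.
have wB : bounded_sums (fun k => w (K0 + k)%N).
  pose th' k := th (K0 + k)%N.
  have hth k : th' k.+1 = th' k \/ th' k.+1 = th' k + 1.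
    have [z zsol] := SOL_nonempty; have [+ _] := desc _ _ (K0k k) zsol.
    by rewrite /th' addnS.
  have [B hB] := theta_cost_summable (fun k => th1 (K0 + k)%N) hth.
  by exists B => k; apply: le_trans (hB k); rewrite /w /th'; under [leRHS]eq_bigr do rewrite addnS.
have yhE k : yh k = proj X (x k - (gamma * rho ^+ m k) *: Hxi k (x k)) by [].
clearbody b w th m yh x; clear stateE sum_x sum_ideal sum_yh.
pose tmin := gamma * rho ^+ N.
have tmin0 : 0 < tmin by exact: trial_step_gt0.
have [xs xs_sol x_xs] : exists2 xs, SOL X H xs & (fun k => x (K0 + k)%N) @ \oo --> xs.
  apply: (@quasi_fejer_cvg _ _ X H X_closed Lam Lam_ge0 H_lip _ (fun k => yh (K0 + k)%N)
    (fun k => Hxi (K0 + k)%N (x (K0 + k)%N)) (fun k => b (K0 + k)%N) xc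
    ((1 - 3 * mu ^+ 2) / 2) tmin^-1) => //.
  - by lra.
  - by rewrite invr_ge0 ltW.
  - exact: bounded_sums_shift.
  - move=> z zsol.
    have [C C0 hC] := step_error_le X_closed X_convex gamma_gt0 gamma_le1 rho_gt0 rho_lt1
      Lam_ge0 H_lip xc zsol A0.
    pose D := M * (1 + M) * nu ^+ 2.
    have D0 : 0 <= D by rewrite /D mulr_ge0 ?sqr_ge0// mulr_ge0; lra.
    exists ((1 + M) * C), (fun k => (1 + M) * C * b (K0 + k)%N + D * w (K0 + k)%N).
    have MC0 : 0 <= (1 + M) * C by rewrite mulr_ge0//; lra.
    split => //.
    + by move=> k; rewrite addr_ge0 ?mulr_ge0// ?w0//; lra.
    + apply: bounded_sumsD; apply: bounded_sumsZ => //; exact: bounded_sums_shift.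
    + move=> k; rewrite addnS; have [_ dk] := desc _ _ (K0k k) zsol.
      have := hC _ (Heta (K0 + k)%N) _ (m (K0 + k)%N) _ (Hxi_lip _ (K0k k)) (b_x _)
         (b_ideal _ (K0k k)).
      rewrite -yhE => /(_ (b_yh _) (bA _)).
      have M10 : 0 <= 1 + M by lra.
      move=> /(ler_wpM2l M10); move: dk; rewrite -/D.
      move: (enorm (x _ - _)) (enorm _) (step_error _ _ _ _ _) (enorm _) (b _) (w _) => p q s r u v.
      by move: ((1 - 3 * mu ^+ 2) / 2) => c; lra.
  - by move=> k; rewrite yhE; exact: proj_in.
  - move=> k q Xq; set j := (K0 + k)%N.
    have := proj_obtuse X_closed X_convex X0 (x j - (gamma * rho ^+ m j) *: Hxi j (x j)) Xq.
    rewrite -yhE; set t := gamma * _.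
    have t0 : 0 < t by exact: trial_step_gt0.
    have tt : tmin <= t.
      rewrite /tmin /t ler_wpM2l ?(ltW gamma_gt0)//.
      by rewrite ler_wiXn2l ?ltW//; have [] := ls _ (K0k k).
    have := cauchy_schwarz (x j - yh j) (yh j - q); rewrite (enormB (yh j)).
    move=> cs ob.
    have h : t * dotv (Hxi j (x j)) (yh j - q) <= enorm (x j - yh j) * enorm (q - yh j).
      apply: le_trans cs; move: ob; clearbody t; move: (yh j) (x j) (Hxi j (x j)) => y v g.
      rewrite !dotvE; lra.
    rewrite -mulrA ler_pdivlMl//.
    have [d0|/ltW d0] := leP (dotv (Hxi j (x j)) (yh j - q)) 0.
      apply: (@le_trans _ _ 0); last by rewrite mulr_ge0 ?enorm_ge0.
      by rewrite mulr_ge0_le0// ltW.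
    by apply: le_trans h; rewrite ler_wpM2r.
  - move=> k; rewrite (rel_errorE _ _ xc) ler_wpM2r ?addr_ge0 ?enorm_ge0//.
exists xs => //; rewrite -(cvg_shiftn K0).
by under eq_fun do rewrite addnC.
Qed.

End seg_path.

(** * Borel measurability in R^n *)

Section borel_Rn.
Context {R : realType}.

Lemma measurable_continuousR {n} (g : 'rV[R]_n -> R) : continuous g ->
  measurable_fun setT (g : borelRn R n -> R).
Proof.
move=> /continuousP cg; apply: (measurability _ (RGenOpens.measurableE R)).
move=> _ [_ [a [b ->] <-]]; rewrite setTI.
by apply: sub_sigma_algebra; apply: cg; exact: interval_open.
Qed.

Lemma measurable_continuousV {m n} (g : 'rV[R]_m -> 'rV[R]_n) : continuous g ->
  measurable_fun setT (g : borelRn R m -> borelRn R n).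
Proof.
move=> /continuousP cg; apply: (@measurability _ _ _ (borelRn R n) _ _ (@open 'rV[R]_n)) => //.
by move=> _ [U oU <-]; rewrite setTI; apply: sub_sigma_algebra; exact: cg.
Qed.

Lemma rV_coord_continuous {n} (i : 'I_n) : continuous (fun v : 'rV[R]_n => v 0 i).
Proof.
apply: (@lipschitz_continuousR _ _ _ 1) => x y; rewrite mul1r.
by apply: le_trans (coord_le_enorm (x - y) i); rewrite !mxE.
Qed.

(** Second countability of R^n, in the form that reduces Borel measurability to
    coordinates. *)
Lemma open_rational_boxes {n} (U : set 'rV[R]_n) y : open U -> U y ->
  exists (q : 'rV[rat]_n) (m : nat),
    (forall i, `|y 0 i - ratr (q 0 i)| < m.+1%:R^-1) /\
    [set v : 'rV[R]_n | forall i, `|v 0 i - ratr (q 0 i)| < m.+1%:R^-1] `<=` U.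
Proof.
move=> oU Uy; have /nbhs_ballP[e /= e0 eU] : nbhs y U by exact: open_nbhs_nbhs.
have [m me] : exists m : nat, m.+1%:R^-1 < e / 2 :> R.
  have e2 : 0 < e / 2 by rewrite divr_gt0.
  have /cvgrPdist_lt/(_ (e / 2) e2)[m _ /(_ m (leqnn m))/=] := @cvg_harmonic R.
  by rewrite sub0r normrN ger0_norm ?invr_ge0// => h; exists m.
have m0 : 0 < m.+1%:R^-1 :> R by rewrite invr_gt0 ltr0n.
have qex i : exists q : rat, `|y 0 i - ratr q| < m.+1%:R^-1.
  have : y 0 i - m.+1%:R^-1 < y 0 i + m.+1%:R^-1.
    by rewrite ltrBlDr -addrA ltrDl addr_gt0.
  move=> /rat_in_itvoo[q]; rewrite in_itv/= => /andP[q1 q2]; exists q.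
  move: q1 q2; rewrite ltr_norml; move: (m.+1%:R^-1) => s q1 q2.
  by apply/andP; split; lra.
pose q := \row_i sval (cid (qex i)).
have qP i : `|y 0 i - ratr (q 0 i)| < m.+1%:R^-1 by rewrite mxE; exact: (svalP (cid (qex i))).
exists q, m; split=> // v vq; apply: eU; split=> // i j; rewrite ord1 -ball_normE/=.
have -> : y 0 j - v 0 j = (y 0 j - ratr (q 0 j)) - (v 0 j - ratr (q 0 j)) by ring.
apply: le_lt_trans (ler_normB _ _) _; apply: lt_trans (ltrD (qP j) (vq j)) _.
by rewrite [ltRHS](splitr e) ltrD.
Qed.

Context {d} {W : measurableType d}.

Lemma measurable_rVP {n} (f : W -> 'rV[R]_n) :
  measurable_fun setT (f : W -> borelRn R n) <->
  forall i, measurable_fun setT (fun w => f w 0 i).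
Proof.
split=> [mf i|mf].
  exact: (measurableT_comp (measurable_continuousR (@rV_coord_continuous n i)) mf).
apply: (@measurability _ _ _ (borelRn R n) _ _ (@open 'rV[R]_n)) => //.
move=> _ [U oU <-]; rewrite setTI.
pose box (p : 'rV[rat]_n * nat) : set 'rV[R]_n :=
  [set v | forall i, `|v 0 i - ratr (p.1 0 i)| < p.2.+1%:R^-1].
pose F p : set W := if `[< box p `<=` U >] then f @^-1` (box p) else set0.
have -> : f @^-1` U = \bigcup_p F p.
  apply/seteqP; split=> w /=.
    move=> /(open_rational_boxes oU)[q [m [wq qU]]].
    by exists (q, m) => //; rewrite /F asboolT.
  by move=> [p _]; rewrite /F; case: asboolP => // pU /pU.
apply: countable_bigcupT_measurable; first exact: countableP.
move=> p; rewrite /F; case: asboolP => // _.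
have -> : f @^-1` box p = ~` \bigcup_i
    ~` ((fun w => `|f w 0 i - ratr (p.1 0 i)|) @^-1` `]-oo, p.2.+1%:R^-1[).
  rewrite setC_bigcup; apply/seteqP; split=> w /=.
    by move=> wp i _; rewrite setCK /= in_itv/=.
  by move=> wp i; have := wp i I; rewrite setCK /= in_itv/=.
apply: measurableC; apply: countable_bigcupT_measurable; first exact: countableP.
move=> i; apply: measurableC; rewrite -[X in measurable X]setTI.
have mg : measurable_fun setT (fun w => `|f w 0 i - ratr (p.1 0 i)|).
  by apply: measurableT_comp => //; apply: measurable_funB => //; exact: mf.
by apply: mg => //; exact: measurable_itv.
Qed.

Lemma measurable_rVD {n} (f g : W -> 'rV[R]_n) :
  measurable_fun setT (f : W -> borelRn R n) -> measurable_fun setT (g : W -> borelRn R n) ->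
  measurable_fun setT ((fun w => f w + g w) : W -> borelRn R n).
Proof.
move=> /measurable_rVP mf /measurable_rVP mg; apply/measurable_rVP => i.
by under eq_fun do rewrite mxE; apply: measurable_funD.
Qed.

Lemma measurable_rVZ {n} (a : W -> R) (f : W -> 'rV[R]_n) :
  measurable_fun setT a -> measurable_fun setT (f : W -> borelRn R n) ->
  measurable_fun setT ((fun w => a w *: f w) : W -> borelRn R n).
Proof.
move=> ma /measurable_rVP mf; apply/measurable_rVP => i.
by under eq_fun do rewrite mxE; apply: measurable_funM.
Qed.

Lemma measurable_rVB {n} (f g : W -> 'rV[R]_n) :
  measurable_fun setT (f : W -> borelRn R n) -> measurable_fun setT (g : W -> borelRn R n) ->
  measurable_fun setT ((fun w => f w - g w) : W -> borelRn R n).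
Proof.
move=> mf mg; under eq_fun do rewrite -scaleN1r.
by apply: measurable_rVD => //; apply: measurable_rVZ.
Qed.

Lemma measurable_enorm {n} (f : W -> 'rV[R]_n) :
  measurable_fun setT (f : W -> borelRn R n) -> measurable_fun setT (fun w => enorm (f w)).
Proof. exact: measurableT_comp (measurable_continuousR enorm_continuous). Qed.

Lemma measurable_dotv {n} (f g : W -> 'rV[R]_n) :
  measurable_fun setT (f : W -> borelRn R n) -> measurable_fun setT (g : W -> borelRn R n) ->
  measurable_fun setT (fun w => dotv (f w) (g w)).
Proof.
move=> /measurable_rVP mf /measurable_rVP mg.
by apply: measurable_sum => i; apply: measurable_funM.
Qed.

Lemma measurable_if_rV {n} (b : W -> bool) (f g : W -> 'rV[R]_n) :
  measurable_fun setT b ->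
  measurable_fun setT (f : W -> borelRn R n) -> measurable_fun setT (g : W -> borelRn R n) ->
  measurable_fun setT ((fun w => if b w then f w else g w) : W -> borelRn R n).
Proof. exact: measurable_fun_ifT. Qed.

(** A preimage splits along the countably many values of the index. *)
Lemma measurable_countable_choice d' (E : measurableType d') (I : W -> nat) (f : nat -> W -> E) :
  (forall m, measurable (I @^-1` [set m])) -> (forall m, measurable_fun setT (f m)) ->
  measurable_fun setT (fun w => f (I w) w).
Proof.
move=> mI mf _ A mA; rewrite setTI.
have -> : (fun w => f (I w) w) @^-1` A = \bigcup_m (I @^-1` [set m] `&` f m @^-1` A).
  by apply/seteqP; split=> w /=; [move=> ?; exists (I w)|move=> [m _ [<-]]].
apply: bigcupT_measurable => m; apply: measurableI => //.
by rewrite -[X in measurable X]setTI; exact: mf.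
Qed.

Lemma measurable_invR (f : W -> R) : (forall w, 0 <= f w) ->
  measurable_fun setT f -> measurable_fun setT (fun w => (f w)^-1).
Proof.
move=> f0 mf; under eq_fun do rewrite -powR_inv1//.
exact: (measurableT_comp (measurable_powR (-1)) mf).
Qed.

End borel_Rn.

(** * Measurability of the iteration *)

Section seg_measurability.
Context {R : realType} {n : nat} {d : measure_display} {W : measurableType d}.
Variable X : set 'rV[R]_n.
Hypotheses (X_closed : closed X) (X_convex : @convex_set R 'rV[R]_n X).
Hypothesis X_nonempty : X !=set0.
Variables (gamma rho mu nu tau M : R).
Implicit Types (G Gxi Geta : W -> 'rV[R]_n -> 'rV[R]_n) (x y : W -> 'rV[R]_n).

Local Notation rVmeasurable f := (measurable_fun setT (f : W -> borelRn R n)).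

(** Substitution of a measurable random point into a random operator; this is how
    joint measurability of the operator is used along the iteration. *)
Definition random_operator G :=
  forall y, rVmeasurable y -> rVmeasurable (fun w => G w (y w)).

Lemma random_operator_sample_mean d' (Xi : measurableType d')
    (T : Xi -> 'rV[R]_n -> 'rV[R]_n) N (z : 'I_N -> W -> Xi) :
  measurable_fun setT (fun a : Xi * borelRn R n => T a.1 a.2 : borelRn R n) ->
  (forall j, measurable_fun setT (z j)) ->
  random_operator (fun w => sample_mean T (fun j => z j w)).
Proof.
move=> mT mz y my; apply: measurable_rVZ; first exact: measurable_cst.
apply/measurable_rVP => i; under eq_fun do rewrite summxE.
apply: measurable_sum => j.
have mp : measurable_fun setT (fun w => (z j w, y w) : Xi * borelRn R n).
  by apply: measurable_fun_pair.
have := @measurableT_comp _ _ _ _ _ _ _ _ _ mT mp.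
by move=> /measurable_rVP/(_ i).
Qed.

Lemma measurable_proj x : rVmeasurable x -> rVmeasurable (fun w => proj X (x w)).
Proof.
move=> mx; have cp := proj_continuous X_closed X_convex X_nonempty.
exact: (@measurableT_comp _ _ _ _ _ _ _ _ _ (measurable_continuousV cp) mx).
Qed.

Lemma measurable_trial_point G x (t : W -> R) : random_operator G -> rVmeasurable x ->
  measurable_fun setT t -> rVmeasurable (fun w => proj X (x w - t w *: G w (x w))).
Proof.
move=> mG mx mt; apply: measurable_proj; apply: measurable_rVB => //.
by apply: measurable_rVZ => //; exact: mG.
Qed.

Lemma measurable_line_search_test G x (t : R) : random_operator G -> rVmeasurable x ->
  measurable_fun setT (fun w => line_search_test X mu (G w) (x w) t).
Proof.
move=> mG mx; rewrite /line_search_test/=.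
have my : rVmeasurable (fun w => proj X (x w - t *: G w (x w))).
  by apply: (@measurable_trial_point _ _ (cst t)).
apply: measurable_fun_ler; apply: measurable_funM => //; apply: measurable_enorm.
- by apply: measurable_rVB; [exact: mG|exact: (mG _ my)].
- exact: measurable_rVB.
Qed.

(** The event splits into the first success at trial [m] and, for [m = 0] only, the event
    that no trial ever succeeds, where the search returns its default value. *)
Lemma measurable_line_search_index G x m : random_operator G -> rVmeasurable x ->
  measurable ((fun w => line_search_index X gamma rho mu (G w) (x w)) @^-1` [set m]).
Proof.
move=> mG mx.
pose A k := [set w | line_search_test X mu (G w) (x w) (gamma * rho ^+ k)].
have mA k : measurable (A k).
  rewrite -[A k]setTI; have := measurable_line_search_test (gamma * rho ^+ k) mG mx.
  by move=> /(_ measurableT [set true]); exact.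
have mA' k : measurable (~` A k) by exact: measurableC.
pose first k := A k `&` \bigcap_(i in [set i | (i < k)%N]) ~` A i.
have mfirst k : measurable (first k).
  by apply: measurableI => //; apply: bigcap_measurableType.
pose acc w := [set k | line_search_test X mu (G w) (x w) (gamma * rho ^+ k) /\
  forall i, (i < k)%N -> ~~ line_search_test X mu (G w) (x w) (gamma * rho ^+ i)].
have firstE w k : first k w <-> acc w k.
  by split=> -[a h]; split=> // i ik; [apply/negP; exact: h|apply/negP; exact: h].
have acc_inj w k l : acc w k -> acc w l -> k = l.
  move=> [ak hk] [al hl]; apply/eqP; rewrite eqn_leq.
  by apply/andP; split; rewrite leqNgt; apply/negP; [move=> /hk; rewrite al|move=> /hl; rewrite ak].
have never_m : measurable (\bigcap_k ~` first k).
  by apply: bigcap_measurableType => k _; exact: measurableC.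
have -> : (fun w => line_search_index X gamma rho mu (G w) (x w)) @^-1` [set m] =
    first m `|` (if m == 0%N then \bigcap_k ~` first k else set0).
  apply/seteqP; split=> w; rewrite /= /line_search_index -/(acc w).
    case: xgetP => [k -> ak <-|no <-]; first by left; apply/firstE.
    by right=> k _ /firstE; exact: no.
  case=> [/firstE am|].
    case: xgetP => [k _ ak|/(_ m)//]; exact: acc_inj am.
  case: eqP => // -> h; case: xgetP => // k _ /firstE ak.
  by have := h k I.
by apply: measurableU => //; case: ifP.
Qed.

Lemma measurable_accepted_point G x : random_operator G -> rVmeasurable x ->
  rVmeasurable (fun w =>
    proj X (x w - line_search_step X gamma rho mu (G w) (x w) *: G w (x w))).
Proof.
move=> mG mx; apply: (@measurable_countable_choice _ W _ (borelRn R n)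
  (fun w => line_search_index X gamma rho mu (G w) (x w))
  (fun m w => proj X (x w - (gamma * rho ^+ m) *: G w (x w)))) => m.
  exact: measurable_line_search_index.
exact: (@measurable_trial_point _ _ (cst (gamma * rho ^+ m))).
Qed.

Lemma measurable_line_search_step G x : random_operator G -> rVmeasurable x ->
  measurable_fun setT (fun w => line_search_step X gamma rho mu (G w) (x w)).
Proof.
move=> mG mx; apply: (@measurable_countable_choice _ W _ R
  (fun w => line_search_index X gamma rho mu (G w) (x w))
  (fun m w => gamma * rho ^+ m)) => m; last exact: measurable_cst.
exact: measurable_line_search_index.
Qed.

Lemma measurable_anderson_coef (th : W -> R) (F Ft : W -> 'rV[R]_n) :
  measurable_fun setT th -> rVmeasurable F -> rVmeasurable Ft ->
  measurable_fun setT (fun w => anderson_coef nu tau M (th w) (F w) (Ft w)).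
Proof.
move=> mth mF mFt; rewrite /anderson_coef; apply: measurable_fun_ifT.
- apply: measurable_fun_ltr; first exact: measurable_enorm.
  apply: measurable_minr; first exact: measurable_enorm.
  by apply: measurable_funM => //; exact: (measurableT_comp (measurable_powR (- tau)) mth).
- apply: measurable_funM.
    by apply: measurable_dotv => //; exact: measurable_rVB.
  apply: measurable_invR; first by move=> w; exact: sqr_ge0.
  by apply: measurable_funX; apply: measurable_enorm; exact: measurable_rVB.
- exact: measurable_cst.
Qed.

Lemma measurable_seg_step Gxi Geta (s : W -> 'rV[R]_n * R) :
  random_operator Gxi -> random_operator Geta ->
  rVmeasurable (fun w => (s w).1) -> measurable_fun setT (fun w => (s w).2) ->
  let s' w := seg_step X gamma rho mu nu tau M (Gxi w) (Geta w) (s w) in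
  rVmeasurable (fun w => (s' w).1) /\ measurable_fun setT (fun w => (s' w).2).
Proof.
move=> mGxi mGeta mx mth s'.
pose x w := (s w).1; pose th w := (s w).2.
pose t w := line_search_step X gamma rho mu (Gxi w) (x w).
pose yh w := proj X (x w - t w *: Gxi w (x w)).
pose y w := proj X (x w - t w *: Geta w (yh w)).
pose al w := anderson_coef nu tau M (th w) (yh w - x w) (y w - x w).
pose stop w := proj X (x w - gamma *: Gxi w (x w)) - x w == 0.
pose ext w := `|al w| <= M.
have s'1 w : (s' w).1 = if stop w then x w
    else if ext w then al w *: x w + (1 - al w) *: y w else y w.
  rewrite /s' /ext /al /y /yh /t /stop /x /th; case: (s w) => /= ? ?.
  by rewrite /seg_step; case: ifP => //= _; case: ifP.
have s'2 w : (s' w).2 = if stop w then th w else if ext w then th w + 1 else th w.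
  rewrite /s' /ext /al /y /yh /t /stop /x /th; case: (s w) => /= ? ?.
  by rewrite /seg_step; case: ifP => //= _; case: ifP.
have mt : measurable_fun setT t by exact: measurable_line_search_step.
have myh : rVmeasurable yh by exact: measurable_accepted_point.
have my : rVmeasurable y.
  apply: measurable_proj; apply: measurable_rVB => //.
  by apply: measurable_rVZ => //; exact: mGeta.
have mal : measurable_fun setT al.
  by apply: measurable_anderson_coef => //; exact: measurable_rVB.
have mstop : measurable_fun setT stop.
  have -> : stop = (fun w => enorm (proj X (x w - gamma *: Gxi w (x w)) - x w) == 0).
    apply/funext => w; rewrite /stop; apply/eqP/eqP => [->|]; first exact: enorm0.
    exact: enorm_eq0.
  apply: measurable_fun_eqr; last exact: measurable_cst.
  apply: measurable_enorm; apply: measurable_rVB => //.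
  exact: (@measurable_trial_point _ _ (cst gamma)).
have mext : measurable_fun setT ext.
  by apply: measurable_fun_ler; [exact: measurableT_comp|exact: measurable_cst].
split.
  rewrite (funext s'1); apply: measurable_if_rV => //; apply: measurable_if_rV => //.
  apply: measurable_rVD; apply: measurable_rVZ => //.
  by apply: measurable_funB => //; exact: measurable_cst.
rewrite (funext s'2); apply: measurable_fun_ifT => //; apply: measurable_fun_ifT => //.
by apply: measurable_funD => //; exact: measurable_cst.
Qed.

Lemma measurable_seg_state (Hxi Heta : nat -> W -> 'rV[R]_n -> 'rV[R]_n) x0 k :
  rVmeasurable x0 -> (forall i, (i < k)%N -> random_operator (Hxi i)) ->
  (forall i, (i < k)%N -> random_operator (Heta i)) ->
  let s w := seg_state X gamma rho mu nu tau M (Hxi ^~ w) (Heta ^~ w) (x0 w) k in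
  rVmeasurable (fun w => (s w).1) /\ measurable_fun setT (fun w => (s w).2).
Proof.
move=> mx0; elim: k => [|k IH] mxi meta /=; first by split => //; exact: measurable_cst.
have [i ik|i ik|m1 m2] := IH; [by apply: mxi; exact: ltnW|by apply: meta; exact: ltnW|].
by apply: measurable_seg_step => //; [exact: mxi|exact: meta].
Qed.

End seg_measurability.

(** * Independence and second moments *)

Section joint_law.
Context {d d1 d2 : measure_display} {Omega : measurableType d}
  {E1 : measurableType d1} {E2 : measurableType d2} {R : realType}.
Variable P : probability Omega R.
Local Open Scope ereal_scope.

Definition mfun_of {d' : measure_display} {E : measurableType d'} (f : Omega -> E)
    (mf : measurable_fun setT f) : {mfun Omega >-> E} :=
  MeasurableFun.Pack (MeasurableFun.Class (isMeasurableFun.Build _ _ _ _ f mf)).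

Definition indep_maps (U : Omega -> E1) (V : Omega -> E2) :=
  forall A B, measurable A -> measurable B ->
    P (U @^-1` A `&` V @^-1` B) = P (U @^-1` A) * P (V @^-1` B).

Variables (U : {mfun Omega >-> E1}) (V : {mfun Omega >-> E2}).
Hypothesis UV : indep_maps U V.

Let UVm : measurable_fun setT (fun w => (U w, V w)).
Proof. exact: measurable_fun_pair. Qed.

Lemma indep_joint_law (Z : set (E1 * E2)) : measurable Z ->
  (distribution P U \x distribution P V) Z = distribution P (mfun_of UVm) Z.
Proof.
by move=> mZ; exact: product_measure_unique.
Qed.

(** Independence says that the joint law is the product of the laws on rectangles, hence
    everywhere, so conditioning on [V] is Fubini's theorem. *)
Lemma indep_integral_ge0 (f : E1 * E2 -> \bar R) : measurable_fun setT f ->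
  (forall z, 0 <= f z) ->
  \int[P]_w f (U w, V w) = \int[distribution P V]_y \int[distribution P U]_x f (x, y).
Proof.
move=> mf f0.
have := @ge0_integral_distribution _ _ _ _ _ P (mfun_of UVm) f mf f0.
rewrite /comp /= => <-.
have := @fubini_tonelli2 _ _ _ _ _ (distribution P U) (distribution P V) f mf f0.
move=> <-; apply: eq_measure_integral => Z mZ _; exact/esym/indep_joint_law.
Qed.

Lemma indep_integral (f : E1 * E2 -> \bar R) : measurable_fun setT f ->
  P.-integrable setT (fun w => f (U w, V w)) ->
  \int[P]_w f (U w, V w) = \int[distribution P V]_y \int[distribution P U]_x f (x, y).
Proof.
move=> mf intf.
have := @integral_distribution _ _ _ _ _ P (mfun_of UVm) f mf intf.
rewrite /comp /= => <-.
rewrite (@integral21_prod_meas1 _ _ _ _ _ (distribution P U) (distribution P V) f).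
  by apply: eq_measure_integral => Z mZ _; exact/esym/indep_joint_law.
apply/integrable21ltyP => //.
have /integrableP[_] := intf; congr (_ < _).
rewrite (indep_integral_ge0 (f := fun z => `|f z|)) //.
exact: measurableT_comp.
Qed.

End joint_law.

Section uncorrelated.
Context {d d' : measure_display} {Omega : measurableType d} {Xi : measurableType d'}
  {R : realType}.
Variable P : probability Omega R.
Local Open Scope ereal_scope.

Lemma same_law_integral (U V : {mfun Omega >-> Xi}) (f : Xi -> \bar R) :
  same_law P U V -> \int[distribution P U]_x f x = \int[distribution P V]_x f x.
Proof. by move=> UV; apply: eq_measure_integral => A mA _; exact: UV. Qed.

Lemma integrable_prod_sqr (f g : Omega -> R) : measurable_fun setT f -> measurable_fun setT g ->
  \int[P]_w ((f w) ^+ 2)%:E < +oo -> \int[P]_w ((g w) ^+ 2)%:E < +oo ->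
  P.-integrable setT (fun w => (f w * g w)%:E).
Proof.
move=> mf mg f2 g2; apply: (@le_integrable _ _ _ _ _ _ _
  (fun w => (f w ^+ 2)%:E + (g w ^+ 2)%:E)) => //.
- by apply/measurable_EFinP; exact: measurable_funM.
- move=> w _ /=; rewrite lee_fin normrM (ger0_norm (addr_ge0 (sqr_ge0 _) (sqr_ge0 _))).
  have sq (a : R) : (a ^+ 2 = `|a| ^+ 2)%R by rewrite real_normK ?num_real.
  rewrite (sq (f w)) (sq (g w)).
  have := sqr_ge0 (`|f w| - `|g w|)%R; have := sqr_ge0 `|f w|%R; have := sqr_ge0 `|g w|%R.
  by move: `|f w|%R `|g w|%R => a b; lra.
- apply: integrableD => //; apply/integrableP; split.
  + by apply/measurable_EFinP; exact: measurable_funX.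
  + by under eq_integral do rewrite gee0_abs ?lee_fin ?sqr_ge0//.
  + by apply/measurable_EFinP; exact: measurable_funX.
  + by under eq_integral do rewrite gee0_abs ?lee_fin ?sqr_ge0//.
Qed.

End uncorrelated.

Lemma integral_probability_cst {d} {W : measurableType d} {R : realType}
  (Q : probability W R) (c : R) : (\int[Q]_w c%:E = c%:E)%E.
Proof. by rewrite integral_cst//= probability_setT mule1. Qed.

Section second_moment.
Context {d d' de : measure_display} {Omega : measurableType d} {Xi : measurableType d'}
  {E : measurableType de} {R : realType}.
Variables (P : probability Omega R) (xi : {mfun Omega >-> Xi}).
Variables (g : Xi * E -> R) (K : R).
Hypothesis g_measurable : measurable_fun setT g.
Local Open Scope ereal_scope.
Hypothesis g_centered : forall y, \int[distribution P xi]_z (g (z, y))%:E = 0.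
Hypothesis g_sqr : forall y, \int[distribution P xi]_z (g (z, y) ^+ 2)%:E <= K%:E.

Let g_slice y : measurable_fun setT (fun z => g (z, y)).
Proof. exact: measurable_fun_pair1. Qed.

Let g_at (U : {mfun Omega >-> Xi}) (V : {mfun Omega >-> E}) :
  measurable_fun setT (fun w => g (U w, V w)).
Proof. by apply: (measurableT_comp g_measurable); exact: measurable_fun_pair. Qed.

Let g_sqr_at (U : {mfun Omega >-> Xi}) y : same_law P U xi ->
  \int[P]_w (g (U w, y) ^+ 2)%:E <= K%:E.
Proof.
move=> Uxi.
rewrite -[leLHS](@ge0_integral_distribution _ _ _ _ _ P U (fun z => (g (z, y) ^+ 2)%:E)).
- by rewrite (same_law_integral _ Uxi).
- by apply/measurable_EFinP; exact: measurable_funX.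
- by move=> z; rewrite lee_fin sqr_ge0.
Qed.

Lemma indep_second_moment (U : {mfun Omega >-> Xi}) (Y : {mfun Omega >-> E}) :
  same_law P U xi -> indep_maps P U Y -> \int[P]_w (g (U w, Y w) ^+ 2)%:E <= K%:E.
Proof.
move=> Uxi UY; rewrite (indep_integral_ge0 UY (f := fun z => (g z ^+ 2)%:E)).
- apply: (@le_trans _ _ (\int[distribution P Y]_y K%:E)).
    apply: ge0_le_integral => //.
    + by move=> y _; apply: integral_ge0 => z _; rewrite lee_fin sqr_ge0.
    + apply: (@measurable_fun_fubini_tonelli_G _ _ _ _ _ (distribution P U)
        (fun z => (g z ^+ 2)%:E)).
        by apply/measurable_EFinP; exact: measurable_funX.
      by move=> z; rewrite lee_fin sqr_ge0.
    + by move=> y _; rewrite (same_law_integral _ Uxi).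
  by rewrite integral_probability_cst.
- by apply/measurable_EFinP; exact: measurable_funX.
- by move=> z; rewrite lee_fin sqr_ge0.
Qed.

(** Conditionally on the random parameter the two factors are independent and
    centred. *)
Lemma indep_cross_moment (U V : {mfun Omega >-> Xi}) (Y : {mfun Omega >-> E}) :
  same_law P U xi -> same_law P V xi -> indep_maps P U V ->
  indep_maps P U Y -> indep_maps P V Y ->
  indep_maps P (fun w => (U w, V w)) Y ->
  \int[P]_w (g (U w, Y w) * g (V w, Y w))%:E = 0.
Proof.
move=> Uxi Vxi UV UY VY UVY.
have mUV : measurable_fun setT (fun w => (U w, V w)) by exact: measurable_fun_pair.
have mprod : measurable_fun setT
    (fun z : Xi * Xi * E => (g (z.1.1, z.2) * g (z.1.2, z.2))%:E).
  apply/measurable_EFinP; apply: measurable_funM; apply: (measurableT_comp g_measurable);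
  by apply: measurable_fun_pair => //; exact: measurableT_comp.
have := @indep_integral _ _ _ _ _ _ _ P (mfun_of mUV) Y UVY _ mprod.
move=> /= ->; last first.
  by apply: integrable_prod_sqr => //; apply: le_lt_trans (ltry K); exact: indep_second_moment.
apply: integral0_eq => y _.
have mh : measurable_fun setT (fun z : Xi * Xi => (g (z.1, y) * g (z.2, y))%:E).
  apply/measurable_EFinP; apply: measurable_funM; apply: (measurableT_comp (g_slice y)) => //.
have sqy (W : {mfun Omega >-> Xi}) : same_law P W xi -> \int[P]_w (g (W w, y) ^+ 2)%:E < +oo.
  by move=> Wxi; apply: le_lt_trans (ltry K); exact: g_sqr_at.
have inty : P.-integrable setT (fun w => (g (U w, y) * g (V w, y))%:E).
  apply: integrable_prod_sqr; [| |exact: sqy|exact: sqy].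
  - exact: (measurableT_comp (g_slice y)).
  - exact: (measurableT_comp (g_slice y)).
have := @integral_distribution _ _ _ _ _ P (mfun_of mUV) _ mh inty.
move=> /= ->; rewrite /comp/=.
rewrite (indep_integral UV mh inty) /=.
apply: integral0_eq => b _.
under eq_integral do rewrite EFinM.
rewrite integralZr//.
  by rewrite (same_law_integral _ Uxi) g_centered mul0e.
have -> : (fun z => (g (z, y))%:E) = (fun z => (g (z, y) * 1)%:E).
  by apply/funext => z; rewrite mulr1.
apply: integrable_prod_sqr => //.
- rewrite (same_law_integral _ Uxi); exact: le_lt_trans (g_sqr y) (ltry K).
- by under eq_integral do rewrite expr1n; rewrite (integral_probability_cst _ 1%R) ltry.
Qed.

Lemma sum_second_moment N (s : 'I_N -> {mfun Omega >-> Xi}) (Y : {mfun Omega >-> E}) :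
  (forall j, same_law P (s j) xi) ->
  (forall j l, j != l -> indep_maps P (s j) (s l)) ->
  (forall j, indep_maps P (s j) Y) ->
  (forall j l, j != l -> indep_maps P (fun w => (s j w, s l w)) Y) ->
  \int[P]_w ((\sum_j g (s j w, Y w)) ^+ 2)%:E <= (N%:R * K)%:E.
Proof.
move=> law ind indY ind2.
have mom j : \int[P]_w (g (s j w, Y w) ^+ 2)%:E <= K%:E by exact: indep_second_moment.
have int_jl j l : P.-integrable setT (fun w => (g (s j w, Y w) * g (s l w, Y w))%:E).
  by apply: integrable_prod_sqr => //; apply: le_lt_trans (ltry K).
under eq_integral => w _.
  rewrite expr2 mulr_suml -sumEFin.
  under eq_bigr => j _ do rewrite mulr_sumr -sumEFin.
  over.
rewrite integral_sum//; last by move=> j; apply: (integrable_sum measurableT) => l _.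
apply: (@le_trans _ _ (\sum_(j < N) K%:E)); last first.
  by rewrite sumEFin sumr_const card_ord mulr_natl.
apply: lee_sum => j _; rewrite integral_sum//.
rewrite (bigD1 j)//= big1 ?adde0; first exact: (mom j).
move=> l lj; apply: indep_cross_moment => //; [apply: ind|apply: ind2]; by rewrite eq_sym.
Qed.

End second_moment.

(** * Almost sure summability of batch errors *)

Section almost_sure_summability.
Context {d : measure_display} {Omega : measurableType d} {R : realType}.
Variable P : probability Omega R.

(** By monotone convergence the random series has a finite mean, so it is finite almost
    surely. *)
Lemma ae_bounded_sums (X : nat -> Omega -> R) (c : nat -> R) :
  (forall k, measurable_fun setT (X k)) -> (forall k w, 0 <= X k w) ->
  (forall k, (\int[P]_w (X k w)%:E <= (c k)%:E)%E) -> bounded_sums c ->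
  {ae P, forall w, bounded_sums (X ^~ w)}.
Proof.
move=> mX X0 Xc [A cA].
have mX' k : measurable_fun setT (fun w => (X k w)%:E) by apply/measurable_EFinP.
have X0' k w : setT w -> (0 <= (X k w)%:E)%E by rewrite lee_fin.
pose F w := (\sum_(k <oo) (X k w)%:E)%E.
have F0 w : (0 <= F w)%E by apply: nneseries_ge0 => k _ _; rewrite lee_fin.
have FA : (\int[P]_w F w <= A%:E)%E.
  rewrite integral_nneseries//; apply: lime_le.
    by apply: is_cvg_nneseries => k _ _; apply: integral_ge0 => w _; exact: X0'.
  apply: nearW => k; apply: (@le_trans _ _ (\sum_(0 <= i < k) (c i)%:E)%E).
    by apply: lee_sum => i _.
  by rewrite sumEFin lee_fin big_mkord.
have intF : P.-integrable setT F.
  apply/integrableP; split.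
    by apply: ge0_emeasurable_sum => // k w _ _; rewrite lee_fin.
  under eq_integral do rewrite gee0_abs//.
  exact: le_lt_trans FA (ltry A).
apply: filterS (integrable_ae measurableT intF) => w /(_ I) Ffin.
exists (fine (F w)) => k; rewrite -lee_fin fineK// -(big_mkord xpredT (X^~ w)) -sumEFin.
by apply: nneseries_lim_ge => i _ _; rewrite lee_fin.
Qed.

Context {d' de : measure_display} {Xi : measurableType d'} {E : measurableType de}.
Variable xi : {mfun Omega >-> Xi}.

Lemma mutually_indep_pair N (s : 'I_N -> {mfun Omega >-> Xi}) j l :
  mutually_indep P (fun j => s j : Omega -> Xi) -> j != l -> indep_maps P (s j) (s l).
Proof.
move=> ind jl A B mA mB.
have := ind [set j; l]%SET (fun i => if i == j then A else B).
rewrite !big_setU1/= ?inE// !big_set1 eqxx eq_sym (negbTE jl); apply.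
by move=> i; case: ifP.
Qed.

Lemma sigma_batch_pair (S : nat -> nat) (s : forall k, 'I_(S k) -> Omega -> Xi) k j l D :
  measurable D -> sigma_batch s k ((fun w => (s k j w, s k l w)) @^-1` D).
Proof.
move=> mD; pose W := g_sigma_algebraType (batch_events s k).
have ms i : measurable_fun setT (s k i : W -> Xi).
  move=> _ A mA; apply: sub_sigma_algebra; exists i => //.
  by exists A.
have mp : measurable_fun setT (fun w : W => (s k j w, s k l w)) by exact: measurable_fun_pair.
by have := mp measurableT D mD; rewrite setTI.
Qed.

Lemma sigma_batch_single (S : nat -> nat) (s : forall k, 'I_(S k) -> Omega -> Xi) k j A :
  measurable A -> sigma_batch s k (s k j @^-1` A).
Proof. by move=> mA; apply: sub_sigma_algebra; exists j => //; exists A => //; rewrite setTI. Qed.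

(** The variance of a batch mean is of order [1 / S k]. As [1 / sqrt (S k)] is
    summable, its square root already is, so the absolute errors are summable and no
    cancellation between iterations is used. *)
Lemma batch_mean_summable (S : nat -> nat) (s : forall k, 'I_(S k) -> {mfun Omega >-> Xi})
    (F : nat -> set_system Omega) (Y : nat -> {mfun Omega >-> E}) (g : Xi * E -> R) (K : R) :
  (forall k, (0 < S k)%N) -> bounded_sums (fun k => (Num.sqrt (S k)%:R)^-1 : R) ->
  (forall k j, same_law P (s k j) xi) ->
  (forall k, mutually_indep P (fun j => s k j : Omega -> Xi)) ->
  (forall k, indep_systems P (sigma_batch s k) (F k)) ->
  (forall k C, measurable C -> F k (Y k @^-1` C)) ->
  measurable_fun setT g ->
  (forall y, \int[distribution P xi]_z (g (z, y))%:E = 0)%E ->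
  (forall y, \int[distribution P xi]_z (g (z, y) ^+ 2)%:E <= K%:E)%E ->
  {ae P, forall w, bounded_sums (fun k => `|(S k)%:R^-1 * \sum_(j < S k) g (s k j w, Y k w)|)}.
Proof.
move=> S0 SB law iid ind YF mg gc g2.
have K0 : 0 <= K.
  rewrite -lee_fin; have [y|noE] := pselect (exists y : E, True); last first.
    by exfalso; apply: noE; exists point.
  by case: y => y _; apply: le_trans (g2 y); apply: integral_ge0 => z _; rewrite lee_fin sqr_ge0.
pose q k : R := Num.sqrt (S k)%:R.
have q0 k : 0 < q k by rewrite sqrtr_gt0 ltr0n.
have qq k : q k ^+ 2 = (S k)%:R by rewrite sqr_sqrtr.
pose sum k w := \sum_(j < S k) g (s k j w, Y k w).
have msum k : measurable_fun setT (sum k).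
  apply: measurable_sum => j; apply: (measurableT_comp mg); exact: measurable_fun_pair.
pose X k w := q k ^- 3 * sum k w ^+ 2.
have XB : {ae P, forall w, bounded_sums (X ^~ w)}.
  apply: (@ae_bounded_sums _ (fun k => K * (q k)^-1)).
  - by move=> k; apply: measurable_funM => //; exact: measurable_funX.
  - by move=> k w; rewrite mulr_ge0 ?sqr_ge0// invr_ge0 exprn_ge0// ltW.
  - move=> k; have q3 : 0 <= q k ^- 3 by rewrite invr_ge0 exprn_ge0// ltW.
    under eq_integral do rewrite EFinM.
    rewrite ge0_integralZl_EFin//; [|by move=> w _; rewrite lee_fin sqr_ge0|
      by apply/measurable_EFinP; exact: measurable_funX].
    have : (\int[P]_w (sum k w ^+ 2)%:E <= ((S k)%:R * K)%:E)%E.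
      apply: (sum_second_moment mg gc g2) => //.
      + by move=> j l; exact: mutually_indep_pair.
      + by move=> j A B mA mB; apply: ind; [exact: sigma_batch_single|exact: YF].
      + by move=> j l _ A B mA mB; apply: ind; [exact: sigma_batch_pair|exact: YF].
    have q3' : (0 <= (q k ^- 3)%:E)%E by rewrite lee_fin.
    move=> /(lee_wpmul2l q3')/le_trans; apply.
    rewrite -EFinM lee_fin -qq.
    have -> : q k ^- 3 * (q k ^+ 2 * K) = K * (q k)^-1 by field; rewrite gt_eqF.
    by [].
  - exact: bounded_sumsZ.
apply: filterS XB => w XB.
apply: (@bounded_sums_le _ _ (fun k => X k w + (q k)^-1)); last exact: bounded_sumsD.
move=> k; rewrite -/(sum k w) normrM ger0_norm ?invr_ge0// -qq /X.
rewrite -[sum k w ^+ 2]real_normK ?num_real//; move: `|sum k w| => v.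
have i0 : 0 < (q k)^-1 by rewrite invr_gt0.
rewrite -!exprVn; move: (q k)^-1 i0 => i i0.
have -> : i ^+ 3 * v ^+ 2 = i * (i * v) ^+ 2 by ring.
have -> : i ^+ 2 * v = i * (i * v) by ring.
rewrite -[X in _ + X]mulr1 -mulrDr ler_wpM2l ?(ltW i0)//.
by move: (i * v) => u; have := sqr_ge0 (u - 2^-1); lra.
Qed.

End almost_sure_summability.

(** * Moments of the operator *)

Section moments.
Context {d : measure_display} {Xi : measurableType d} {R : realType}.
Variable Q : probability Xi R.
Implicit Types f phi : Xi -> R.

Definition square_integrable phi := (\int[Q]_z (phi z ^+ 2)%:E < +oo)%E.

Lemma ae_le_integral f phi : measurable_fun setT f -> measurable_fun setT phi ->
  (forall z, 0 <= f z) -> (forall z, 0 <= phi z) -> {ae Q, forall z, f z <= phi z} ->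
  (\int[Q]_z (f z)%:E <= \int[Q]_z (phi z)%:E)%E.
Proof.
move=> mf mphi f0 phi0 fphi.
have -> : (\int[Q]_z (f z)%:E = \int[Q]_z (Num.min (f z) (phi z))%:E)%E.
  apply: ae_eq_integral => //.
  - exact/measurable_EFinP.
  - by apply/measurable_EFinP; exact: measurable_minr.
  - by apply: filterS fphi => z fz _; rewrite min_l.
apply: ge0_le_integral => //.
- by move=> z _; rewrite lee_fin le_min f0 phi0.
- by apply/measurable_EFinP; exact: measurable_minr.
- exact/measurable_EFinP.
- by move=> z _; rewrite lee_fin ge_min lexx orbT.
Qed.

Lemma square_integrable_integrable phi : measurable_fun setT phi -> square_integrable phi ->
  Q.-integrable setT (fun z => (phi z)%:E).
Proof.
move=> mphi phi2; have -> : (fun z => (phi z)%:E) = (fun z => (phi z * 1)%:E).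
  by apply/funext => z; rewrite mulr1.
apply: integrable_prod_sqr => //.
under eq_integral do rewrite expr1n.
by rewrite (integral_probability_cst Q 1) ltry.
Qed.

Lemma square_integrableD f phi : measurable_fun setT f -> measurable_fun setT phi ->
  square_integrable f -> square_integrable phi -> square_integrable (fun z => f z + phi z).
Proof.
move=> mf mphi f2 phi2.
have sq (g : Xi -> R) : measurable_fun setT g -> measurable_fun setT (fun z => (g z ^+ 2)%:E).
  by move=> mg; apply/measurable_EFinP; exact: measurable_funX.
have sqi (g : Xi -> R) : measurable_fun setT g -> square_integrable g ->
    Q.-integrable setT (fun z => (g z ^+ 2)%:E).
  move=> mg g2; apply/integrableP; split; first exact: sq.
  by under eq_integral do rewrite gee0_abs ?lee_fin ?sqr_ge0//.
have mS : measurable_fun setT (fun z => f z + phi z) by exact: measurable_funD.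
have : Q.-integrable setT (fun z => ((2%:E * (f z ^+ 2)%:E) + (2%:E * (phi z ^+ 2)%:E))%E).
  by apply: integrableD => //; apply: integrableZl => //; exact: sqi.
move=> /integrableP[_]; apply: le_lt_trans; apply: ge0_le_integral => //.
- by move=> z _; rewrite lee_fin sqr_ge0.
- exact: sq.
- apply: measurableT_comp => //; apply: emeasurable_funD; apply: measurable_funeM; exact: sq.
- move=> z _ /=; rewrite lee_fin ger0_norm; last first.
    by apply: addr_ge0; apply: mulr_ge0; rewrite ?sqr_ge0.
  by have := sqr_ge0 (f z - phi z); lra.
Qed.

Lemma square_integrable_cst (c : R) : square_integrable (fun=> c).
Proof. by rewrite /square_integrable integral_probability_cst ltry. Qed.

(** A higher moment bounds the second one because the total mass is finite. *)
Lemma square_integrable_powR f (p : R) : 2 <= p -> measurable_fun setT f -> (forall z, 0 <= f z) ->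
  (\int[Q]_z (f z `^ p)%:E < +oo)%E -> square_integrable f.
Proof.
move=> p2 mf f0 fp.
have mp : measurable_fun setT (fun z => (f z `^ p)%:E).
  by apply/measurable_EFinP; exact: (measurableT_comp (measurable_powR p) mf).
have p0 z : (0 <= (f z `^ p)%:E)%E by rewrite lee_fin powR_ge0.
apply: (@le_lt_trans _ _ (\int[Q]_z (1%:E + (f z `^ p)%:E))%E).
  apply: ge0_le_integral => //.
  - by move=> z _; rewrite lee_fin sqr_ge0.
  - by apply/measurable_EFinP; exact: measurable_funX.
  - exact: emeasurable_funD.
  - move=> z _; rewrite lee_fin; have [f1|/ltW f1] := leP (f z) 1.
      by apply: (@le_trans _ _ 1); rewrite ?exprn_ile1// lerDl powR_ge0.
    by rewrite -powR_mulrn// ler_wpDl// ler_powR.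
rewrite ge0_integralD//.
by rewrite (integral_probability_cst Q 1) lte_add_pinfty// ltry.
Qed.

Lemma dominated_integrable f phi (c : R) : 0 <= c -> (forall z, 0 <= phi z) ->
  measurable_fun setT f -> measurable_fun setT phi -> square_integrable phi ->
  {ae Q, forall z, `|f z| <= c * phi z} ->
  Q.-integrable setT (fun z => (f z)%:E) /\
  `|fine (\int[Q]_z (f z)%:E)| <= c * fine (\int[Q]_z (phi z)%:E).
Proof.
move=> c0 phi0 mf mphi phi2 fphi.
have iphi := square_integrable_integrable mphi phi2.
have mn : measurable_fun setT (fun z => `|f z|) by exact: measurableT_comp.
have f_le : (\int[Q]_z (`|f z|)%:E <= c%:E * \int[Q]_z (phi z)%:E)%E.
  rewrite -ge0_integralZl_EFin//; [|by move=> z _; rewrite lee_fin|exact/measurable_EFinP].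
  under [leRHS]eq_integral do rewrite -EFinM.
  apply: ae_le_integral => //; last by move=> z; rewrite mulr_ge0.
  by apply: measurable_funM => //; exact: measurable_cst.
have phifin := integrable_fin_num measurableT iphi.
have lefin : (\int[Q]_z (`|f z|)%:E < +oo)%E.
  by apply: le_lt_trans f_le _; rewrite -(fineK phifin) -EFinM ltry.
have fi : Q.-integrable setT (fun z => (f z)%:E).
  by apply/integrableP; split => //; exact/measurable_EFinP.
split => //; rewrite -lee_fin -[leLHS]/(`|(fine (\int[Q]_z (f z)%:E))%:E|%E) fineK; last first.
  exact: integrable_fin_num.
apply: le_trans (le_abse_integral _ _ _) _ => //; first exact/measurable_EFinP.
by apply: le_trans f_le _; rewrite EFinM fineK.
Qed.

End moments.

Section operator_moments.
Context {d : measure_display} {Xi : measurableType d} {R : realType} {n : nat}.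
Variables (Q : probability Xi R) (T : Xi -> 'rV[R]_n -> 'rV[R]_n) (L : Xi -> R).
Variables (xc : 'rV[R]_n) (H : 'rV[R]_n -> 'rV[R]_n).
Hypothesis T_measurable :
  measurable_fun setT (fun a : Xi * borelRn R n => T a.1 a.2 : borelRn R n).
Hypotheses (L_measurable : measurable_fun setT L) (L_ge0 : forall z, 0 <= L z).
Hypothesis T_lip : {ae Q, forall z, forall x y, enorm (T z x - T z y) <= L z * enorm (x - y)}.
Hypothesis T_sqr : square_integrable Q (fun z => enorm (T z xc)).
Hypothesis L_sqr : square_integrable Q L.
Hypothesis H_mean : forall y i, H y 0 i = fine (\int[Q]_z (T z y 0 i)%:E).

(** The mean Lipschitz constant, up to the factor [n] lost by working
    coordinatewise. *)
Definition mean_lip : R := n%:R * fine (\int[Q]_z (L z)%:E).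

Let phi z := enorm (T z xc) + L z.

Let T_slice y : measurable_fun setT (fun z => T z y : borelRn R n).
Proof. exact: (measurable_fun_pair1 (y : borelRn R n) T_measurable). Qed.

Let mT y i : measurable_fun setT (fun z => T z y 0 i).
Proof. exact: (measurable_rVP _).1 (T_slice y) i. Qed.

Let mTxc : measurable_fun setT (fun z => enorm (T z xc)).
Proof. exact: measurable_enorm. Qed.

Let mphi : measurable_fun setT phi.
Proof. exact: measurable_funD. Qed.

Let phi0 z : 0 <= phi z.
Proof. by rewrite addr_ge0 ?enorm_ge0. Qed.

Let phi2 : square_integrable Q phi.
Proof. exact: square_integrableD. Qed.

Let T_le y i : {ae Q, forall z, `|T z y 0 i| <= (1 + enorm (y - xc)) * phi z}.
Proof.
apply: filterS T_lip => z lip; apply: le_trans (coord_le_enorm _ i) _.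
have := enorm_triangleB (T z xc) (T z y) 0; rewrite !subr0.
have := lip y xc; have := enorm_ge0 (T z xc); have := L_ge0 z; have := enorm_ge0 (y - xc).
by rewrite /phi; move: (enorm _) (enorm _) (enorm _) (enorm _) => p q r s; nra.
Qed.

Let c_ge0 y : 0 <= 1 + enorm (y - xc).
Proof. by rewrite addr_ge0 ?enorm_ge0. Qed.

Lemma operator_integrable y i : Q.-integrable setT (fun z => (T z y 0 i)%:E).
Proof. exact: (dominated_integrable (c_ge0 y) phi0 (mT y i) mphi phi2 (T_le y i)).1. Qed.

Let T_int y i : Q.-integrable setT (fun z => (T z y 0 i)%:E).
Proof. exact: operator_integrable. Qed.

Let H_int y i : (\int[Q]_z (T z y 0 i)%:E = (H y 0 i)%:E)%E.
Proof. by rewrite H_mean fineK// integrable_fin_num. Qed.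

Lemma mean_lip_ge0 : 0 <= mean_lip.
Proof. by rewrite mulr_ge0// fine_ge0// integral_ge0// => z _; rewrite lee_fin. Qed.

Lemma mean_lipschitz x y : enorm (H x - H y) <= mean_lip * enorm (x - y).
Proof.
apply: le_trans (enorm_le_sum _) _.
apply: (@le_trans _ _ (\sum_(i < n) enorm (x - y) * fine (\int[Q]_z (L z)%:E))); last first.
  by rewrite sumr_const card_ord /mean_lip -mulrA mulr_natl (mulrC (enorm _)).
apply: ler_sum => i _; rewrite !mxE -lee_fin.
have -> : H x 0 i - H y 0 i = fine (\int[Q]_z (T z x 0 i - T z y 0 i)%:E).
  under eq_integral do rewrite EFinB.
  by rewrite integralB// !H_int.
rewrite lee_fin; apply: (dominated_integrable _ L_ge0 _ L_measurable L_sqr _).2.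
- exact: enorm_ge0.
- exact: measurable_funB.
- apply: filterS T_lip => z lip; apply: le_trans (le_trans _ (lip x y)) _; last by rewrite mulrC.
  by have := coord_le_enorm (T z x - T z y) i; rewrite !mxE.
Qed.

(** The noise of one sample, coordinatewise and with the weight of [rel_error]. *)
Definition rel_noise i (a : Xi * borelRn R n) : R :=
  (T a.1 a.2 0 i - H a.2 0 i) / (1 + enorm (a.2 - xc : 'rV[R]_n)).

Lemma measurable_rel_noise i : measurable_fun setT (rel_noise i).
Proof.
have H_cont : continuous H by exact: lipschitz_enorm_continuous mean_lipschitz.
have m2 : measurable_fun setT (fun a : Xi * borelRn R n => a.2) by exact: measurable_snd.
apply: measurable_funM; last first.
  apply: measurable_invR; first by move=> a; exact: c_ge0.
  apply: measurable_funD; first exact: measurable_cst.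
  by apply: measurable_enorm; apply: measurable_rVB => //; exact: measurable_cst.
apply: measurable_funB; first exact: (measurable_rVP _).1 T_measurable i.
apply: (measurable_rVP _).1.
exact: (measurableT_comp (measurable_continuousV H_cont) m2).
Qed.

Lemma rel_noise_centered i y : (\int[Q]_z (rel_noise i (z, y))%:E = 0)%E.
Proof.
rewrite /rel_noise /=; under eq_integral do rewrite EFinM EFinB.
rewrite integralZr//; last by apply: integrableB => //; exact: finite_measure_integrable_cst.
rewrite integralB//; last exact: finite_measure_integrable_cst.
by rewrite H_int integral_probability_cst subee// mul0e.
Qed.

(** By the Lipschitz bound, |T z y| is at most (|T z xc| + L z) (1 + |y - xc|), so after division
    by the weight one square-integrable function of [z] dominates the noise at all [y]. *)
Lemma rel_noise_sqr i : exists K : R, forall y, (\int[Q]_z (rel_noise i (z, y) ^+ 2)%:E <= K%:E)%E.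
Proof.
pose m := fine (\int[Q]_z (phi z)%:E).
have m0 : 0 <= m by rewrite fine_ge0// integral_ge0// => z _; rewrite lee_fin.
have mS : measurable_fun setT (fun z => phi z + m).
  by apply: measurable_funD => //; exact: measurable_cst.
have S2 : square_integrable Q (fun z => phi z + m).
  by apply: square_integrableD => //; exact: square_integrable_cst.
exists (fine (\int[Q]_z ((phi z + m) ^+ 2)%:E)) => y; rewrite fineK; last first.
  by rewrite ge0_fin_numE// integral_ge0// => z _; rewrite lee_fin sqr_ge0.
apply: ae_le_integral.
- apply: measurable_funX; exact: (measurable_fun_pair1 (y : borelRn R n) (measurable_rel_noise i)).
- exact: measurable_funX.
- by move=> z; exact: sqr_ge0.
- by move=> z; exact: sqr_ge0.
have c1 : 0 < 1 + enorm (y - xc) by rewrite ltr_pwDl ?enorm_ge0.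
have Hm := (dominated_integrable (c_ge0 y) phi0 (mT y i) mphi phi2 (T_le y i)).2.
rewrite H_int /= -/m in Hm.
apply: filterS (T_le y i) => z Tz.
have pm0 : 0 <= phi z + m by exact: addr_ge0.
rewrite -real_normK ?num_real// lerXn2r ?nnegrE//.
rewrite /rel_noise/= normrM normfV (ger0_norm (c_ge0 y)) ler_pdivrMr//.
by apply: le_trans (ler_normB _ _) _; rewrite mulrDl; apply: lerD; rewrite mulrC.
Qed.

End operator_moments.

(** * Batches and filtrations *)

Section sampling.
Context {R : realType} {n : nat} {d' : measure_display} {Xi : measurableType d'}.
Variables (T : Xi -> 'rV[R]_n -> 'rV[R]_n).

Lemma rel_error_sample_mean_le (H : 'rV[R]_n -> 'rV[R]_n) xc N (z : 'I_N -> Xi) y :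
  (0 < N)%N -> rel_error H (sample_mean T z) xc y <=
    \sum_(i < n) `|N%:R^-1 * \sum_(j < N) rel_noise T xc H i (z j, y : borelRn R n)|.
Proof.
move=> N0; have N1 : N%:R != 0 :> R by rewrite pnatr_eq0 -lt0n.
have c0 : 0 < 1 + enorm (y - xc) by rewrite ltr_pwDl ?enorm_ge0.
rewrite /rel_error ler_pdivrMr// mulr_suml.
apply: le_trans (enorm_le_sum _) _; apply: ler_sum => i _.
rewrite /rel_noise/= -mulr_suml mulrA normrM normfV (ger0_norm (ltW c0)) divfK ?gt_eqF//.
by rewrite !mxE summxE sumrB sumr_const card_ord mulrBr -[H y 0 i *+ N]mulr_natl mulKf.
Qed.

Lemma sample_mean_lipschitz (L : Xi -> R) N (z : 'I_N -> Xi) :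
  (forall j x y, enorm (T (z j) x - T (z j) y) <= L (z j) * enorm (x - y)) ->
  forall x y, enorm (sample_mean T z x - sample_mean T z y)
    <= N%:R^-1 * \sum_(j < N) L (z j) * enorm (x - y).
Proof.
move=> lip x y; rewrite /sample_mean -scalerBr -sumrB enormZ ger0_norm ?invr_ge0//.
rewrite ler_wpM2l ?invr_ge0//.
elim/big_ind2: _ => [|u a v b ua vb|j _]; [by rewrite enorm0| |exact: lip].
exact: le_trans (enorm_triangle _ _) (lerD ua vb).
Qed.

Lemma ae_same_law {d} {Omega : measurableType d} (P : probability Omega R)
    (s xi : {mfun Omega >-> Xi}) (A : Xi -> Prop) :
  same_law P s xi -> {ae distribution P xi, forall z, A z} -> {ae P, forall w, A (s w)}.
Proof.
move=> law [B [mB B0 AB]]; exists (s @^-1` B); split.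
- by rewrite -[X in measurable X]setTI; exact: measurable_funP.
- by rewrite (law _ mB).
- by move=> w /= nA; exact: AB.
Qed.

End sampling.

Section adapted.
Context {R : realType} {n : nat} {d' : measure_display} {Xi : measurableType d'}.
Variables (X : set 'rV[R]_n) (T : Xi -> 'rV[R]_n -> 'rV[R]_n) (S : nat -> nat).
Hypotheses (X_closed : closed X) (X_convex : @convex_set R 'rV[R]_n X).
Hypothesis X_nonempty : X !=set0.
Hypothesis T_measurable :
  measurable_fun setT (fun z : Xi * borelRn R n => T z.1 z.2 : borelRn R n).
Variables (gamma rho mu nu tau M : R).

Definition seg_process {W : Type} (xs es : forall k, 'I_(S k) -> W -> Xi)
    (x0 : W -> 'rV[R]_n) k w : 'rV[R]_n :=
  seg_iterate X gamma rho mu nu tau M (fun i => sample_mean T (fun j => xs i j w))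
    (fun i => sample_mean T (fun j => es i j w)) (x0 w) k.

Definition half_process {W : Type} (xs es : forall k, 'I_(S k) -> W -> Xi)
    (x0 : W -> 'rV[R]_n) k w : 'rV[R]_n :=
  let G := sample_mean T (fun j => xs k j w) in
  let x := seg_process xs es x0 k w in
  proj X (x - line_search_step X gamma rho mu G x *: G x).

Lemma measurable_seg_process {d} {W : measurableType d}
    (xs es : forall k, 'I_(S k) -> W -> Xi) (x0 : W -> 'rV[R]_n) k :
  measurable_fun setT (x0 : W -> borelRn R n) ->
  (forall i j, (i < k)%N -> measurable_fun setT (xs i j)) ->
  (forall i j, (i < k)%N -> measurable_fun setT (es i j)) ->
  measurable_fun setT (seg_process xs es x0 k : W -> borelRn R n).
Proof.
move=> mx0 mxs mes.
have [//|i ik|i ik|m _] := @measurable_seg_state R n d W X X_closed X_convex X_nonempty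
  gamma rho mu nu tau M (fun i w => sample_mean T (fun j => xs i j w))
  (fun i w => sample_mean T (fun j => es i j w)) x0 k.
- by apply: random_operator_sample_mean => // j; exact: mxs.
- by apply: random_operator_sample_mean => // j; exact: mes.
- exact: m.
Qed.

Lemma measurable_half_process {d} {W : measurableType d}
    (xs es : forall k, 'I_(S k) -> W -> Xi) (x0 : W -> 'rV[R]_n) k :
  measurable_fun setT (x0 : W -> borelRn R n) ->
  (forall i j, (i < k.+1)%N -> measurable_fun setT (xs i j)) ->
  (forall i j, (i < k)%N -> measurable_fun setT (es i j)) ->
  measurable_fun setT (half_process xs es x0 k : W -> borelRn R n).
Proof.
move=> mx0 mxs mes.
apply: (@measurable_accepted_point R n d W X X_closed X_convex X_nonempty gamma rho mu
  (fun w => sample_mean T (fun j => xs k j w)) (seg_process xs es x0 k)).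
  by apply: random_operator_sample_mean => // j; exact: mxs.
by apply: measurable_seg_process => // i j ik; apply: mxs; exact: ltnW.
Qed.

Lemma measurable_ideal_process {d} {W : measurableType d} (H : 'rV[R]_n -> 'rV[R]_n)
    (x : W -> 'rV[R]_n) m : continuous H ->
  measurable_fun setT (x : W -> borelRn R n) ->
  measurable_fun setT ((fun w => ideal_point X H gamma rho m (x w)) : W -> borelRn R n).
Proof.
move=> cH mx; apply: (@measurable_trial_point R n d W X X_closed X_convex X_nonempty
  (fun=> H) x (cst (gamma * rho ^+ m))) => //.
by move=> y my; exact: (measurableT_comp (measurable_continuousV cH) my).
Qed.

Context {d : measure_display} {Omega : measurableType d}.
Variables (xs es : forall k, 'I_(S k) -> Omega -> Xi) (x0 : Omega -> 'rV[R]_n).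

(** Adaptedness: whatever proves [f] measurable from its ingredients proves it on any copy
    of the sample space for which these ingredients are measurable, in particular on the one
    that carries the sigma-algebra of the past. *)
Lemma filtF_preimage {de} {E : measurableType de} (f : Omega -> E) k :
  (forall (W := g_sigma_algebraType (init_events x0 `|` \bigcup_(i < k) batch_events xs i
        `|` \bigcup_(i < k) batch_events es i)),
     measurable_fun setT (x0 : W -> borelRn R n) ->
     (forall i j, (i < k)%N -> measurable_fun setT (@xs i j : W -> Xi)) ->
     (forall i j, (i < k)%N -> measurable_fun setT (@es i j : W -> Xi)) ->
     measurable_fun setT (f : W -> E)) ->
  forall C, measurable C -> filtF x0 xs es k (f @^-1` C).
Proof.
move=> mf C mC; rewrite -[_ @^-1` _]setTI; apply: mf => //.
- by move=> _ A mA; apply: sub_sigma_algebra; left; left; exists A.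
- move=> i j ik _ A mA; apply: sub_sigma_algebra; left; right.
  by exists i => //; exists j => //; exists A.
- move=> i j ik _ A mA; apply: sub_sigma_algebra; right.
  by exists i => //; exists j => //; exists A.
Qed.

Lemma filtFhat_preimage {de} {E : measurableType de} (f : Omega -> E) k :
  (forall (W := g_sigma_algebraType (init_events x0 `|` \bigcup_(i < k.+1) batch_events xs i
        `|` \bigcup_(i < k) batch_events es i)),
     measurable_fun setT (x0 : W -> borelRn R n) ->
     (forall i j, (i < k.+1)%N -> measurable_fun setT (@xs i j : W -> Xi)) ->
     (forall i j, (i < k)%N -> measurable_fun setT (@es i j : W -> Xi)) ->
     measurable_fun setT (f : W -> E)) ->
  forall C, measurable C -> filtFhat x0 xs es k (f @^-1` C).
Proof.
move=> mf C mC; rewrite -[_ @^-1` _]setTI; apply: mf => //.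
- by move=> _ A mA; apply: sub_sigma_algebra; left; left; exists A.
- move=> i j ik _ A mA; apply: sub_sigma_algebra; left; right.
  by exists i => //; exists j => //; exists A.
- move=> i j ik _ A mA; apply: sub_sigma_algebra; right.
  by exists i => //; exists j => //; exists A.
Qed.

End adapted.

(** * Almost sure convergence *)

Theorem theorem3p2
  (R : realType) (n : nat)
  (d : measure_display) (Omega : measurableType d) (P : probability Omega R)
  (d' : measure_display) (Xi : measurableType d')
  (X : set 'rV[R]_n) (T : Xi -> 'rV[R]_n -> 'rV[R]_n) (xi : {mfun Omega >-> Xi})
  (X_closed : closed X)
  (X_convex : @convex_set R 'rV[R]_n X)
  (T_measurable :
     measurable_fun setT (fun z : Xi * borelRn R n => T z.1 z.2 : borelRn R n))
  (SOL_nonempty : SOL X (mean_map P T xi) !=set0)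
  (H_pseudomonotone : pseudomonotone X (mean_map P T xi))
  (L : Xi -> R) (L_measurable : measurable_fun setT L)
  (L_ge1 : {ae P, forall w, 1 <= L (xi w)})
  (T_lipschitz : {ae distribution P xi, forall z, forall x y : 'rV[R]_n,
     enorm (T z x - T z y) <= L z * enorm (x - y)})
  (L_moments : forall p : R, 2 <= p ->
     ('E_P[fun w => (L (xi w) `^ (2 * p))%R] < +oo)%E)
  (xcheck : 'rV[R]_n) (qbar : R) (qbar_ge2 : 2 <= qbar)
  (T_moment : ('E_P[fun w => (enorm (T (xi w) xcheck) `^ (2 * qbar))%R] < +oo)%E)
  (x0 : Omega -> 'rV[R]_n)
  (x0_measurable : measurable_fun setT (x0 : Omega -> borelRn R n))
  (x0_in_X : forall w, X (x0 w))
  (nu : R) (nu_ge0 : 0 <= nu)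
  (gamma : R) (gamma_gt0 : 0 < gamma) (gamma_le1 : gamma <= 1)
  (rho : R) (rho_gt0 : 0 < rho) (rho_lt1 : rho < 1)
  (mu : R) (mu_gt0 : 0 < mu) (mu_lt : mu < Num.sqrt 3 / 3)
  (tau : R) (tau_gt : 1 / 2 < tau)
  (M : R) (M_gt0 : 0 < M)
  (S : nat -> nat) (S_gt0 : forall k, (0 < S k)%N)
  (xis etas : forall k, 'I_(S k) -> {mfun Omega >-> Xi})
  (xis_law : forall k j, same_law P (xis k j) xi)
  (etas_law : forall k j, same_law P (etas k j) xi)
  (xis_iid : forall k, mutually_indep P (fun j => xis k j : Omega -> Xi))
  (etas_iid : forall k, mutually_indep P (fun j => etas k j : Omega -> Xi))
  (xis_etas_indep : forall k,
     indep_systems P (sigma_batch xis k) (sigma_batch etas k))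
  (xis_past_indep : forall k,
     indep_systems P (sigma_batch xis k) (filtF x0 xis etas k))
  (etas_past_indep : forall k,
     indep_systems P (sigma_batch etas k) (filtFhat x0 xis etas k))
  (S_summable : cvgn (series (fun k => (Num.sqrt (S k)%:R : R)^-1))) :
  let H := mean_map P T xi in
  let x (k : nat) (w : Omega) : 'rV[R]_n :=
    seg_iterate X gamma rho mu nu tau M
      (fun i => sample_mean T (fun j => xis i j w))
      (fun i => sample_mean T (fun j => etas i j w)) (x0 w) k in
  {ae P, forall w,
    (exists2 xs, SOL X H xs & x ^~ w @ \oo --> xs) /\
    (fun k => residual X H gamma (x k w)) @ \oo --> (0 : R)}.
Proof.
move=> H x.
have X0 : X !=set0 by have [z [Xz _]] := SOL_nonempty; exists z.
have mu3 : 3 * mu ^+ 2 < 1.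
  have s0 : 0 <= Num.sqrt 3 :> R by exact: sqrtr_ge0.
  have s2 : Num.sqrt 3 ^+ 2 = 3 :> R by rewrite sqr_sqrtr.
  have : mu ^+ 2 < (Num.sqrt 3 / 3) ^+ 2 by rewrite ltr_pXn2r ?nnegrE ?(ltW mu_gt0)// divr_ge0.
  by rewrite exprMn s2 exprVn => h; lra.
pose Q : probability Xi R := distribution P xi.
(* The positive part is still a Lipschitz constant, and its powers are controlled by
   those of [L] at every point, not only where [L] is positive. *)
pose Lp z := Num.max (L z) 0.
have Lp0 z : 0 <= Lp z by rewrite le_max lexx orbT.
have mLp : measurable_fun setT Lp by apply: measurable_maxr => //; exact: measurable_cst.
have transfer (f : Xi -> R) : measurable_fun setT f -> (forall z, 0 <= f z) ->
    (\int[Q]_z (f z)%:E = \int[P]_w (f (xi w))%:E)%E.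
  move=> mf f0; apply: (@ge0_integral_distribution _ _ _ _ _ P xi (fun z => (f z)%:E)).
    exact/measurable_EFinP.
  by move=> z; rewrite lee_fin.
have mTxc : measurable_fun setT (fun z => enorm (T z xcheck)).
  apply: measurable_enorm.
  exact: (measurable_fun_pair1 (xcheck : borelRn R n) T_measurable).
have T_sqr : square_integrable Q (fun z => enorm (T z xcheck)).
  apply: (@square_integrable_powR _ _ _ _ _ (2 * qbar)) => //; first by lra.
  - by move=> z; exact: enorm_ge0.
  - rewrite transfer; [|exact: (measurableT_comp (measurable_powR (2 * qbar)) mTxc)|
      by move=> z; exact: powR_ge0].
    by move: T_moment; rewrite unlock.
have L_sqr : square_integrable Q Lp.
  apply: (@square_integrable_powR _ _ _ _ _ (2 * 2)) => //; first by lra.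
  have mL p : measurable_fun setT (fun z => L z `^ p).
    exact: (measurableT_comp (measurable_powR p) L_measurable).
  have mLpp p : measurable_fun setT (fun z => Lp z `^ p).
    exact: (measurableT_comp (measurable_powR p) mLp).
  have : (\int[Q]_z (L z `^ (2 * 2))%:E < +oo)%E.
    rewrite transfer//; last by move=> z; exact: powR_ge0.
    by move: (L_moments 2 (lexx _)); rewrite unlock.
  apply: le_lt_trans; apply: ge0_le_integral => //.
  - by move=> z _; rewrite lee_fin powR_ge0.
  - by apply/measurable_EFinP.
  - by apply/measurable_EFinP.
  - move=> z _; rewrite lee_fin /Lp; have [_|_] := ltP (L z) 0; last by [].
    by rewrite powR0 ?powR_ge0//; apply/eqP; lra.
have T_lip : {ae Q, forall z, forall u v, enorm (T z u - T z v) <= Lp z * enorm (u - v)}.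
  apply: filterS T_lipschitz => z lip u v; apply: le_trans (lip u v) _.
  by rewrite ler_wpM2r ?enorm_ge0// le_max lexx.
have H_mean y i : H y 0 i = fine (\int[Q]_z (T z y 0 i)%:E)%E.
  have iT := operator_integrable T_measurable mLp Lp0 T_lip T_sqr L_sqr y i.
  have mT : measurable_fun setT (fun z => (T z y 0 i)%:E) by case/integrableP : iT.
  rewrite /H /mean_map mxE unlock; congr fine; apply/esym.
  apply: (@integral_distribution _ _ _ _ _ P xi _ mT); apply/integrableP; split.
    exact: (measurableT_comp mT).
  have /integrableP[_] := iT; congr (_ < _)%E.
  rewrite /Q (@ge0_integral_distribution _ _ _ _ _ P xi (fun z => `|(T z y 0 i)%:E|%E))//.
  exact: (measurableT_comp _ mT).
have mean_lip0 := mean_lip_ge0 (n := n) Q Lp0.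
pose Lbar := fine (\int[Q]_z (Lp z)%:E)%E.
have Lbar0 : 0 <= Lbar by rewrite fine_ge0// integral_ge0// => z _; rewrite lee_fin.
(* One constant for the exact operator and, once the mean of [Lp] over the batch is within
   1 of its expectation, for the sampled ones. *)
pose Lam := mean_lip (n := n) Q Lp + Lbar + 1.
have Lam0 : 0 <= Lam by rewrite /Lam; lra.
have H_lip u v : enorm (H u - H v) <= Lam * enorm (u - v).
  apply: le_trans (mean_lipschitz T_measurable mLp Lp0 T_lip T_sqr L_sqr H_mean u v) _.
  by rewrite ler_wpM2r ?enorm_ge0// /Lam; lra.
have H_cont : continuous H by exact: lipschitz_enorm_continuous H_lip.
have SB : bounded_sums (fun k => (Num.sqrt (S k)%:R)^-1 : R).
  by apply: cvg_bounded_sums => // k; rewrite invr_ge0 sqrtr_ge0.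
pose xs k j : Omega -> Xi := xis k j; pose es k j : Omega -> Xi := etas k j.
have noise (s : forall k, 'I_(S k) -> {mfun Omega >-> Xi}) (F : nat -> set_system Omega)
    (Y : nat -> {mfun Omega >-> borelRn R n}) :
    (forall k j, same_law P (s k j) xi) ->
    (forall k, mutually_indep P (fun j => s k j : Omega -> Xi)) ->
    (forall k, indep_systems P (sigma_batch s k) (F k)) ->
    (forall k C, measurable C -> F k (Y k @^-1` C)) ->
    {ae P, forall w, bounded_sums
      (fun k => rel_error H (sample_mean T (fun j => s k j w)) xcheck (Y k w))}.
  move=> law iid ind YF.
  have each i : {ae P, forall w, bounded_sums (fun k => `|(S k)%:R^-1 *
      \sum_(j < S k) rel_noise T xcheck H i (s k j w, Y k w)|)}.
    have [K hK] := rel_noise_sqr T_measurable mLp Lp0 T_lip T_sqr L_sqr H_mean i.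
    apply: (batch_mean_summable S_gt0 SB law iid ind YF _ _ hK).
      exact: (measurable_rel_noise T_measurable mLp Lp0 T_lip T_sqr L_sqr H_mean i).
    exact: (rel_noise_centered T_measurable mLp Lp0 T_lip T_sqr L_sqr H_mean i).
  have all : {ae P, forall w, forall i, bounded_sums (fun k => `|(S k)%:R^-1 *
      \sum_(j < S k) rel_noise T xcheck H i (s k j w, Y k w)|)}.
    exact: filter_forall.
  apply: filterS all => w hw.
  apply: bounded_sums_le; last exact: (bounded_sums_sum (index_enum _) hw).
  by move=> k; exact: rel_error_sample_mean_le.
have mxs k : measurable_fun setT (x k : Omega -> borelRn R n).
  by apply: (@measurable_seg_process _ _ _ _ _ _ _ X_closed X_convex X0 T_measurable
    gamma rho mu nu tau M _ _ xs es x0 k).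
pose yh k := half_process X T gamma rho mu nu tau M xs es x0 k.
have myh k : measurable_fun setT (yh k : Omega -> borelRn R n).
  exact: measurable_half_process.
have mid m k : measurable_fun setT
    ((fun w => ideal_point X H gamma rho m (x k w)) : Omega -> borelRn R n).
  exact: measurable_ideal_process.
have x_past k C : measurable C -> filtF x0 xs es k (mfun_of (mxs k) @^-1` C).
  apply: filtF_preimage => W m0 mx me.
  exact: (measurable_seg_process X_closed X_convex X0 T_measurable gamma rho mu nu tau M m0 mx me).
have id_past m k C : measurable C -> filtF x0 xs es k (mfun_of (mid m k) @^-1` C).
  apply: filtF_preimage => W m0 mx me.
  have mX := measurable_seg_process X_closed X_convex X0 T_measurable
    gamma rho mu nu tau M m0 mx me.
  exact: (measurable_ideal_process X_closed X_convex X0 gamma rho m H_cont mX).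
have yh_past k C : measurable C -> filtFhat x0 xs es k (mfun_of (myh k) @^-1` C).
  apply: filtFhat_preimage => W m0 mx me.
  exact: (measurable_half_process X_closed X_convex X0 T_measurable gamma rho mu nu tau M m0 mx me).
have sum_x := noise _ _ _ xis_law xis_iid xis_past_indep x_past.
have sum_id m := noise _ _ _ xis_law xis_iid xis_past_indep (id_past m).
have sum_yh := noise _ _ _ etas_law etas_iid etas_past_indep yh_past.
have L_lln : {ae P, forall w, bounded_sums (fun k => `|(S k)%:R^-1 *
    \sum_(j < S k) (Lp (xis k j w) - Lbar)|)}.
  have iL := square_integrable_integrable mLp L_sqr.
  have mg : measurable_fun setT (fun z => Lp z - Lbar).
    by apply: measurable_funB => //; exact: measurable_cst.
  have g2 : square_integrable Q (fun z => Lp z - Lbar).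
    by apply: square_integrableD => //; exact: square_integrable_cst.
  apply: (@batch_mean_summable _ _ _ P _ _ _ _ xi S xis _ _
    (fun a : Xi * borelRn R n => Lp a.1 - Lbar) (fine (\int[Q]_z ((Lp z - Lbar) ^+ 2)%:E)%E)
    S_gt0 SB xis_law xis_iid xis_past_indep x_past).
  - exact: (measurableT_comp mg).
  - move=> y /=; under eq_integral do rewrite EFinB.
    rewrite integralB//; last exact: finite_measure_integrable_cst.
    rewrite integral_probability_cst /Lbar fineK ?subee//; exact: integrable_fin_num.
  - move=> y /=; rewrite fineK// ge0_fin_numE// integral_ge0// => z _.
    by rewrite lee_fin sqr_ge0.
have lips : {ae P, forall w, forall k j u v,
    enorm (T (xis k j w) u - T (xis k j w) v) <= Lp (xis k j w) * enorm (u - v)}.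
  apply: ae_foralln => k; apply: filter_forall => j.
  exact: (ae_same_law (xis_law k j) T_lip).
(* From here on, a trajectory outside the exceptional null set is fixed. *)
apply: filterS (filterI (filterI sum_x (ae_foralln sum_id)) (filterI sum_yh (filterI L_lln lips))).
move=> w [[w_x w_id] [w_yh [w_L w_lip]]].
have [K0 hK0] : exists K0, forall k, (K0 <= k)%N ->
    `|(S k)%:R^-1 * \sum_(j < S k) (Lp (xis k j w) - Lbar)| < 1.
  have /cvgrPdist_lt/(_ 1 ltr01)[K _ hK] := bounded_sums_cvg0 (fun k => normr_ge0 _) w_L.
  by exists K => k /hK/=; rewrite sub0r normrN normr_id.
apply: (@seg_path_cvg _ _ X H X_closed X_convex H_pseudomonotone SOL_nonempty gamma rho mu nu tau M
  Lam gamma_gt0 gamma_le1 rho_gt0 rho_lt1 mu_gt0 mu3 nu_ge0 M_gt0 tau_gt Lam0 H_lip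
  (fun i => sample_mean T (fun j => xis i j w)) (fun i => sample_mean T (fun j => etas i j w))
  (x0 w) xcheck K0) => //.
move=> k /hK0 hk u v.
apply: le_trans (sample_mean_lipschitz (w_lip k) u v) _.
rewrite -mulr_suml mulrA ler_wpM2r ?enorm_ge0//.
move: hk; rewrite sumrB sumr_const card_ord mulrBr -[Lbar *+ _]mulr_natl mulKf; last first.
  by rewrite pnatr_eq0 -lt0n.
rewrite ltr_norml => /andP[_]; rewrite /Lam; lra.
Qed.
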